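(* Let $n\geq 2$ be an integer, let $L_{2,n}=L_2\times L_n$ be the product of a $2$-element chain and an $n$-element chain, let $k$ be a field, $S_n=k[y_1,\ldots,y_{3n-2}]$ and $T_n=k[x_1,\ldots,x_{2n}]$, with $I_{\mathrm{LD}}(L_{2,n})\subseteq S_n$ and $I_{n+1}(L_{2,n})\subseteq T_n$. Then $\beta_{0,0}(S_n/I_{\mathrm{LD}}(L_{2,n}))=1$, $\beta_{1,n}(S_n/I_{\mathrm{LD}}(L_{2,n}))=n$ and, for $2\leq i\leq n$, $$\beta_{i,j}(S_n/I_{\mathrm{LD}}(L_{2,n}))=\begin{cases}(2n-j+i-1)\binom{j-n-i}{i-2}, & \text{for } n+2i-2\leq j\leq 2n+i-2,\\ 0, & \text{otherwise.}\end{cases}$$ Moreover, $\beta_{i,j}(S_n/I_{\mathrm{LD}}(L_{2,n}))=0$ for $i>n+1$. In particular, the total Betti numbers are given by $\beta_i(S_n/I_{\mathrm{LD}}(L_{2,n}))=\binom{n}{i}$ for $0\leq i\leq n$. Similarly, $\beta_{0,0}(T_n/I_{n+1}(L_{2,n}))=1$, $\beta_{1,n+1}(T_n/I_{n+1}(L_{2,n}))=n$ and $\beta_{2,n+2}(T_n/I_{n+1}(L_{2,n}))=n-1$, and all the other Betti numbers of $T_n/I_{n+1}(L_{2,n})$ vanish.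
   Context: $L_{2,n}$ has elements $(i,s)$ with $i\in\{0,1\}$, $0\leq s\leq n-1$, ordered by $(i,s)\leq (j,t)$ iff $i\leq j$ and $s\leq t$. Its $2n$ elements are identified with $x_1,\ldots,x_{2n}$ and its $3n-2$ cover relations (edges of the Hasse diagram) with $y_1,\ldots,y_{3n-2}$. $I_{\mathrm{LD}}(L_{2,n})\subseteq S_n$ is the ideal generated by the monomials $\prod_{e\in\pi}y_e$, where $\pi$ runs over the maximal saturated chains of $L_{2,n}$ and the product is over the cover relations (edges) of $\pi$. $I_{n+1}(L_{2,n})\subseteq T_n$ is the path ideal generated by the monomials $\prod_{v\in\pi}x_v$, where $\pi$ runs over the saturated chains with $n+1$ elements (these are the maximal chains) and the product is over the elements of $\pi$. $\beta_{i,j}$ denotes the $\mathbb{Z}$-graded Betti numbers and $\beta_i=\sum_j\beta_{i,j}$; $k$ is arbitrary. *)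

(* Defs.v *)
From HB Require Import structures.
From Stdlib Require Import ClassicalEpsilon.
From mathcomp Require Import all_boot all_order all_algebra zify.
From mathcomp Require Import mpoly.

Set Implicit Arguments.
Unset Strict Implicit.
Unset Printing Implicit Defensive.

Import Order.TTheory GRing.Theory Num.Theory.
Local Open Scope ring_scope.

Section GradedBetti.
Variables (k : fieldType) (m : nat).
Local Notation S := {mpoly k[m]}.

Definition ideal_gen (G : S -> Prop) (p : S) : Prop :=
  exists (r : nat) (c g : 'I_r -> S),
    (forall i, G (g i)) /\ p = \sum_(i < r) c i * g i.

(* Homogeneity for the Z-grading of S; the components of negative degree are
   zero. *)
Definition homog_int (d : int) (p : S) : bool :=
  match d with
  | Posz e => p \is e.-homog
  | Negz _ => p == 0
  end.

(* A sequence ... -> F_2 -> F_1 -> F_0 -> S/I of free modules of finite rank,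
   F_i being the direct sum of the S(-d), d ranging over [fdeg i] (with
   multiplicity). Elements of F_i are row vectors and [fdiff i] acts on them
   from the right, as a map F_(i+1) -> F_i. A map F_0 -> S/I lifts to S, as F_0
   is free; [faug] is the column of such a lift, so that v : F_0 is sent to the
   class of (v *m faug) 0 0 modulo I. *)
Record free_seq := FreeSeq {
  fdeg : nat -> seq int;
  fdiff : forall i : nat, 'M[S]_(size (fdeg i.+1), size (fdeg i));
  faug : 'cV[S]_(size (fdeg 0%N))
}.

Definition free_seq0 : free_seq :=
  @FreeSeq (fun=> [::]) (fun=> 0) 0.

Variable I : S -> Prop.

(* All maps are homogeneous of degree 0: an entry from a generator of degree d
   to a generator of degree e is homogeneous of degree d - e. *)
Definition is_graded (F : free_seq) : Prop :=
  (forall i (a : 'I_(size (fdeg F i.+1))) (b : 'I_(size (fdeg F i))),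
     homog_int ((fdeg F i.+1)`_a - (fdeg F i)`_b) (fdiff F i a b))
  /\ (forall a : 'I_(size (fdeg F 0%N)), homog_int (fdeg F 0%N)`_a (faug F a 0)).

Definition is_resolution (F : free_seq) : Prop :=
  [/\ exists v : 'rV_(size (fdeg F 0%N)), I (1 - (v *m faug F) 0 0),
      forall v : 'rV_(size (fdeg F 0%N)),
        I ((v *m faug F) 0 0) <-> exists w, v = w *m fdiff F 0
    & forall i (v : 'rV_(size (fdeg F i.+1))),
        v *m fdiff F i = 0 <-> exists w, v = w *m fdiff F i.+1].

(* The image of F_(i+1) lies in (x_1, ..., x_m) F_i. *)
Definition is_minimal (F : free_seq) : Prop :=
  forall i a b, (fdiff F i a b)@_0%MM = 0.

Definition minimal_graded_resolution (F : free_seq) : Prop :=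
  [/\ is_graded F, is_resolution F & is_minimal F].

(* The minimal graded free resolution of S/I, which is unique up to
   isomorphism and exists for every homogeneous ideal I. *)
Definition min_res : free_seq :=
  epsilon (inhabits free_seq0) minimal_graded_resolution.

Definition graded_betti (i : nat) (j : int) : nat :=
  count_mem j (fdeg min_res i).

(* The sum of all graded Betti numbers in homological degree i; only the
   degrees j in [fdeg min_res i] contribute. *)
Definition total_betti (i : nat) : nat :=
  \sum_(j <- undup (fdeg min_res i)) graded_betti i j.

End GradedBetti.

Section PosetIdeals.
Variables (d : Order.disp_t) (P : finPOrderType d).
Local Open Scope order_scope.

Definition covers : rel P :=
  fun x y => (x < y) && ~~ [exists z, (x < z) && (z < y)].

Definition hasse_edge : finType := {e : P * P | covers e.1 e.2}.

Definition saturated_chain (s : seq P) : bool := sorted covers s.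

Definition maximal_saturated_chain (s : seq P) : Prop :=
  saturated_chain s /\
  forall t, saturated_chain t -> {subset s <= t} -> {subset t <= s}.

Local Open Scope ring_scope.
Variables (k : fieldType) (m : nat).

Definition edge_monomial (y : hasse_edge -> 'I_m) (s : seq P) : {mpoly k[m]} :=
  \prod_(e : hasse_edge | val e \in zip s (behead s)) 'X_(y e).

Definition vertex_monomial (x : P -> 'I_m) (s : seq P) : {mpoly k[m]} :=
  \prod_(v <- s) 'X_(x v).

(* Here y numbers the edges of the Hasse diagram, and x the elements of P. *)
Definition LD_ideal (y : hasse_edge -> 'I_m) : {mpoly k[m]} -> Prop :=
  ideal_gen (fun p =>
    exists2 s, maximal_saturated_chain s & p = edge_monomial y s).

Definition path_ideal (t : nat) (x : P -> 'I_m) : {mpoly k[m]} -> Prop :=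
  ideal_gen (fun p =>
    exists2 s, saturated_chain s /\ size s = t & p = vertex_monomial x s).

End PosetIdeals.

(* 'I_n is the n-element chain and *p the product order. *)
Definition L2 (n : nat) : finPOrderType _ := ('I_2 *p 'I_n)%type.

Lemma L2_leE n (x y : L2 n) :
  (x <= y)%O = (x.1 <= y.1)%N && (x.2 <= y.2)%N.
Proof. by []. Qed.

Lemma L2_ltE n (x y : L2 n) :
  (x < y)%O = [&& (x.1 <= y.1)%N, (x.2 <= y.2)%N & (x.1 + x.2 < y.1 + y.2)%N].
Proof.
rewrite lt_leAnge !L2_leE; lia.
Qed.

Lemma L2_coversE n (x y : L2 n) :
  covers x y = (((x.1 : nat) == y.1) && (y.2 == x.2.+1 :> nat)) ||
    ((y.1 == x.1.+1 :> nat) && ((x.2 : nat) == y.2)).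
Proof.
case: x y => [a s] [b t]; rewrite /covers L2_ltE /=.
have pE i j : ((i, j) : L2 n).1 = i by [].
have qE i j : ((i, j) : L2 n).2 = j by [].
apply/idP/idP => [/andP[/and3P[ab st lt]]|h].
  rewrite negb_exists => /forallP nz.
  have := nz (a, t); have := nz (b, s).
  rewrite !L2_ltE !pE !qE !ab !st !leqnn /= => h1 h2.
  have [tS|tS] := leqP t s.+1; first by have := ltn_ord b; lia.
  have lts : (s.+1 < n)%N by have := ltn_ord t; lia.
  have := nz (a, Ordinal lts); rewrite !L2_ltE !pE !qE /=; lia.
apply/andP; split; first by lia.
by rewrite negb_exists; apply/forallP => -[c u]; rewrite !L2_ltE !pE !qE; lia.
Qed.

Lemma card_L2 n : #|L2 n| = (2 * n)%N.
Proof. by rewrite card_prod !card_ord. Qed.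

Definition L2_edge_pair n (u : 'I_n + 'I_2 * 'I_n.-1) : L2 n * L2 n :=
  match u with
  | inl s => ((ord0, s), (ord_max, s))
  | inr (i, s) =>
      ((i, widen_ord (leq_pred n) s),
       (i, cast_ord (prednK (leq_ltn_trans (leq0n s) (leq_trans (ltn_ord s) (leq_pred n)))) (lift ord0 s)))
  end.

Lemma L2_edge_pair_inj n : injective (@L2_edge_pair n).
Proof.
move=> [s|[i s]] [t|[j t]] //=.
- by case=> ->.
- by case=> <- _; move=> /(congr1 val).
- by case=> -> _; move=> /(congr1 val).
- by case=> -> st _; have -> : s = t by apply: val_inj.
Qed.

Lemma L2_edge_pairP n (e : L2 n * L2 n) :
  reflect (exists u, e = L2_edge_pair u) (covers e.1 e.2).
Proof.
case: e => -[a s] [b t]; rewrite L2_coversE /=; apply: (iffP idP).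
  case/orP => /andP[/eqP h1 /eqP h2].
    have hs : (s < n.-1)%N by have := ltn_ord t; lia.
    exists (inr (a, Ordinal hs)) => /=.
    by congr ((_, _), (_, _)); apply: val_inj.
  exists (inl s) => /=; congr ((_, _), (_, _)); apply: val_inj => //=.
  - by have := ltn_ord b; lia.
  - by have := ltn_ord b; lia.
case=> -[u|[i u]] /= [-> -> -> ->] /=; first by rewrite eqxx.
by rewrite !eqxx.
Qed.

Lemma card_L2_edge n : #|hasse_edge (L2 n)| = (3 * n - 2)%N.
Proof.
rewrite (card_sig (fun e : L2 n * L2 n => covers e.1 e.2)).
rewrite (@eq_card _ _ (mem (codom (@L2_edge_pair n)))) => [|e].
  rewrite card_codom; last exact: L2_edge_pair_inj.
  by rewrite card_sum card_prod !card_ord; lia.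
rewrite inE; apply/L2_edge_pairP/codomP => -[u ->]; by exists u.
Qed.

Definition edge_var n (e : hasse_edge (L2 n)) : 'I_(3 * n - 2) :=
  cast_ord (card_L2_edge n) (enum_rank e).

Definition vertex_var n (v : L2 n) : 'I_(2 * n) :=
  cast_ord (card_L2 n) (enum_rank v).

Definition I_LD (k : fieldType) (n : nat) : {mpoly k[3 * n - 2]} -> Prop :=
  LD_ideal (@edge_var n).

Definition I_path (k : fieldType) (n t : nat) : {mpoly k[2 * n]} -> Prop :=
  path_ideal t (@vertex_var n).
Arguments I_LD : clear implicits.
Arguments I_path : clear implicits.

(* Main.v *)
(** Minimal graded free resolutions are compared through chain maps built degree
    by degree: modulo the maximal ideal the comparison matrices become mutually
    inverse and respect degrees, so the Betti numbers can be read off any one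
    minimal resolution.

    The maximal chains of [L_{2,n}] are the paths P_s climbing at column s. Only
    the generator of P_s involves the rung s, so distinct sets of generators of
    the edge ideal have distinct lcms and the Taylor resolution is minimal; the
    lcm of the generators in A has degree #A + (max A - min A) + n - 1, and
    subsets of given size and spread are counted by a binomial coefficient. For
    the path ideal, consecutive generators differ by one variable, and these n - 1
    relations give a resolution of Hilbert-Burch type. *)

From HB Require Import structures.
Require Import Defs.
From Stdlib Require Import ClassicalEpsilon.
From mathcomp Require Import all_boot all_order all_algebra zify.
From mathcomp Require Import mpoly.

Set Implicit Arguments.
Unset Strict Implicit.
Unset Printing Implicit Defensive.

Import Order.TTheory GRing.Theory Num.Theory.
Local Open Scope ring_scope.

(** * Homogeneous components of polynomials *)

Section MonomialFilter.
Variables (k : fieldType) (m : nat).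
Local Notation S := {mpoly k[m]}.
Implicit Types (P : pred 'X_{1..m}) (p q : S).

(** The predicate is arbitrary because the filter serves twice: on total degree it gives homogeneous
    components, on divisibility it gives the contracting homotopy of the Taylor complex. *)
Definition mfilter P p : S := \sum_(a <- msupp p | P a) p@_a *: 'X_[a].

Lemma mcoeff_filter P p a : (mfilter P p)@_a = if P a then p@_a else 0.
Proof.
rewrite /mfilter big_mkcond raddf_sum /=.
rewrite (eq_bigr (fun b => (b == a)%:R * (if P a then p@_a else 0))); last first.
  move=> b _; case: (eqVneq b a) => [->|ba]; last first.
    by rewrite mul0r; case: ifP; rewrite ?mcoeff0 // mcoeffZ mcoeffX (negbTE ba) mulr0.
  by case: ifP; rewrite ?mcoeff0 ?mulr0 // mcoeffZ mcoeffX eqxx mulr1 mul1r.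
rewrite -mulr_suml; have [ap|ap] := boolP (a \in msupp p).
  rewrite (bigD1_seq a) ?msupp_uniq //= eqxx big1 ?addr0 ?mul1r //.
  by move=> b /negbTE ->.
by rewrite (memN_msupp_eq0 ap) if_same mulr0.
Qed.

Lemma mfilter_is_zmod_morphism P : zmod_morphism (mfilter P).
Proof.
move=> p q; apply/mpolyP => a; rewrite mcoeffB !mcoeff_filter mcoeffB.
by case: (P a); rewrite ?subr0.
Qed.

HB.instance Definition _ P :=
  GRing.isZmodMorphism.Build S S (mfilter P) (mfilter_is_zmod_morphism P).

(** [d] is an integer so that differences of generator degrees can be used as they are; a negative
    [d] gives 0. *)
Definition hcomp (d : int) : S -> S := mfilter (fun a => (mdeg a)%:Z == d).

HB.instance Definition _ (d : int) := GRing.Additive.on (hcomp d).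

Lemma homog_intP (d : int) p :
  reflect (forall a, p@_a != 0 -> (mdeg a)%:Z = d) (homog_int d p).
Proof.
case: d => d /=.
  apply: (iffP (dhomogP _ _ _)) => h a; first by rewrite -mcoeff_msupp => /h ->.
  by rewrite mcoeff_msupp => /h /= [].
apply: (iffP eqP) => [-> a|h]; first by rewrite mcoeff0 eqxx.
by apply/mpolyP => a; rewrite mcoeff0; apply/eqP/negPn/negP => /h.
Qed.

Lemma homog_hcomp d p : homog_int d (hcomp d p).
Proof.
by apply/homog_intP => a; rewrite mcoeff_filter; case: ifP => [/eqP//|_]; rewrite eqxx.
Qed.

Lemma hcomp_id d p : homog_int d p -> hcomp d p = p.
Proof.
move/homog_intP => h; apply/mpolyP => a; rewrite mcoeff_filter.
by case: eqP => // nd; have [//|/h] := eqVneq (p@_a) 0.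
Qed.

(** Every term of [p] has degree [d], so a product of terms has degree [e] exactly when the factor
    from [q] has degree [e - d]. *)
Lemma hcompMl e d p q : homog_int d p -> hcomp e (p * q) = p * hcomp (e - d) q.
Proof.
move/homog_intP => h; apply/mpolyP => a; rewrite mcoeff_filter !mcoeffM.
case: eqP => ae.
  apply: eq_bigr => -[u v] /= /eqP auv; rewrite mcoeff_filter.
  have [->|/h pu] := eqVneq (p@_u) 0; first by rewrite !mul0r.
  rewrite auv mdegD in ae.
  by have -> : (mdeg v)%:Z == e - d by lia.
rewrite big1 // => -[u v] /= /eqP auv; rewrite mcoeff_filter.
have [->|/h pu] := eqVneq (p@_u) 0; first by rewrite !mul0r.
by case: eqP => [vd|]; rewrite ?mulr0 //; case: ae; rewrite auv mdegD; lia.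
Qed.

Lemma hcompMr e d p q : homog_int d q -> hcomp e (p * q) = hcomp (e - d) p * q.
Proof. by move=> hq; rewrite mulrC (hcompMl _ _ hq) mulrC. Qed.

Lemma homog_int_coef0 d p : homog_int d p -> p@_0%MM != 0 -> d = 0.
Proof. by move/homog_intP => h /h <-; rewrite mdeg0. Qed.

End MonomialFilter.

(** * Ideals given by generators *)

Section IdealGen.
Variables (k : fieldType) (m : nat).
Local Notation S := {mpoly k[m]}.
Implicit Types (G : S -> Prop).

Lemma ideal_gen0 G : ideal_gen G 0.
Proof. by exists 0%N, (fun=> 0), (fun=> 0); split=> [[]|] //; rewrite big_ord0. Qed.

Lemma ideal_gen_mem G p : G p -> ideal_gen G p.
Proof.
by move=> Gp; exists 1%N, (fun=> 1), (fun=> p); split=> //; rewrite big_ord1 mul1r.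
Qed.

Lemma ideal_genM G c p : ideal_gen G p -> ideal_gen G (c * p).
Proof.
case=> r [c' [g [Gg ->]]]; exists r, (fun i => c * c' i), g; split=> //.
by rewrite mulr_sumr; apply: eq_bigr => i _; rewrite mulrA.
Qed.

Lemma ideal_genD G p q : ideal_gen G p -> ideal_gen G q -> ideal_gen G (p + q).
Proof.
case=> r [c [g [Gg ->]]] [r' [c' [g' [Gg' ->]]]].
exists (r + r')%N.
exists (fun i => match split i with inl a => c a | inr b => c' b end).
exists (fun i => match split i with inl a => g a | inr b => g' b end).
split; first by move=> i; case: (split i).
rewrite big_split_ord /=; congr (_ + _); apply: eq_bigr => i _.
  by case: split_ordP => j; [move/lshift_inj-> | move/eqP; rewrite eq_lrshift].
by case: split_ordP => j; [move/eqP; rewrite eq_rlshift | move/rshift_inj->].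
Qed.

Lemma ideal_gen_sum G (T : Type) (s : seq T) (c g : T -> S) :
  (forall i, ideal_gen G (g i)) -> ideal_gen G (\sum_(i <- s) c i * g i).
Proof.
move=> h; elim: s => [|i s IH]; rewrite ?big_nil ?big_cons; first exact: ideal_gen0.
exact/ideal_genD/IH/ideal_genM/h.
Qed.

(** For a homogeneous generator [g], a component of [c * g] is a component of [c] times [g], so it
    stays in the ideal. *)
Lemma ideal_gen_hcomp G d p :
    (forall g, G g -> exists e, homog_int e g) ->
  ideal_gen G p -> ideal_gen G (hcomp d p).
Proof.
move=> hG [r [c [g [Gg ->]]]]; rewrite raddf_sum /=.
apply: (big_ind (ideal_gen G)); [exact: ideal_gen0|exact: ideal_genD|] => i _.
have [e he] := hG _ (Gg i); rewrite (hcompMr _ _ he).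
exact/ideal_genM/ideal_gen_mem.
Qed.

End IdealGen.

(** * Linear algebra for lifting maps and comparing ranks *)

Lemma rowwise_lift (R : comNzRingType) a b c (K : 'rV[R]_b -> Prop) (d : 'M[R]_(c, b))
    (M : 'M_(a, b)) :
    (forall v, K v -> exists w, v = w *m d) -> (forall i, K (row i M)) ->
  exists N, M = N *m d.
Proof.
move=> ex KM.
have h i : {w | row i M = w *m d} by apply/constructive_indefinite_description/ex.
exists (\matrix_i sval (h i)); apply/row_matrixP => i.
by rewrite row_mul rowK; exact: svalP (h i).
Qed.

(** A row of [A] labelled [j] vanishes outside the columns labelled [j], so the blocks of [A] and
    [B] at label [j] still multiply to the identity, which bounds the size of the block by its inner
    dimension. *)
Lemma leq_card_support_mulmx1 (k : fieldType) (p q : nat) (T : eqType) (al : 'I_p -> T)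
    (be : 'I_q -> T) (A : 'M[k]_(p, q)) (B : 'M[k]_(q, p)) (j : T) :
    A *m B = 1%:M -> (forall a b, A a b != 0 -> al a = be b) ->
  (#|[pred a | al a == j]| <= #|[pred b | be b == j]|)%N.
Proof.
move=> AB hA; set P := [pred a | _]; set Q := [pred b | _].
pose A' := \matrix_(x < #|P|, y < #|Q|) A (enum_val x) (enum_val y).
pose B' := \matrix_(y < #|Q|, x < #|P|) B (enum_val y) (enum_val x).
apply: (@mulmx1_min _ _ _ A' B'); apply/matrixP => x y.
rewrite !mxE; under eq_bigr do rewrite !mxE.
have -> : (x == y) = (enum_val x == enum_val y) by rewrite (inj_eq enum_val_inj).
have := congr1 (fun M : 'M_p => M (enum_val x) (enum_val y)) AB; rewrite /= !mxE => <-.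
rewrite -(big_enum_val (fun b => A (enum_val x) b * B b (enum_val y))) /=.
rewrite big_mkcond /=; apply: eq_bigr => b _; rewrite inE; case: eqP => // nb.
have [->|/hA ab] := eqVneq (A (enum_val x) b) 0; first by rewrite mul0r.
by case: nb; rewrite -ab; have := enum_valP x; rewrite inE => /eqP.
Qed.

(** * Independence of the graded Betti numbers from the minimal resolution *)

Section Uniqueness.
Variables (k : fieldType) (m : nat) (G : {mpoly k[m]} -> Prop).
Local Notation S := {mpoly k[m]}.
Local Notation I := (ideal_gen G).
Hypothesis G_homog : forall g, G g -> exists e, homog_int e g.

Local Notation dim F i := (size (fdeg F i)).
Implicit Types F : free_seq k m.

(** In degree 0 the target is the quotient by [I], where being zero means lying in [I]; the case
    split lets exactness be used uniformly in [i]. *)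
Definition in_ker (F : free_seq k m) i : 'rV[S]_(dim F i) -> Prop :=
  match i with
  | 0 => fun v => I ((v *m faug F) 0 0)
  | i.+1 => fun v => v *m fdiff F i = 0
  end.

Definition resolves F := is_resolution I F.

Lemma exactP F i (v : 'rV[S]_(dim F i)) : resolves F ->
  in_ker v <-> exists w, v = w *m fdiff F i.
Proof. by case: i v => [|i] v [_ h0 h1]; [apply: h0|apply: h1]. Qed.

Lemma in_ker_fdiff F i (w : 'rV[S]_(dim F i.+1)) : resolves F -> in_ker (w *m fdiff F i).
Proof. by move=> rF; apply/(exactP _ rF); exists w. Qed.

Lemma fdiff_fdiff F i : resolves F -> fdiff F i.+1 *m fdiff F i = 0.
Proof.
move=> rF; apply/row_matrixP => a.
by rewrite row0 row_mul rowE; apply: (@in_ker_fdiff F i.+1).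
Qed.

Definition graded_map F F' i (f : 'M[S]_(dim F i, dim F' i)) :=
  forall (a : 'I_(dim F i)) (b : 'I_(dim F' i)), homog_int ((fdeg F i)`_a - (fdeg F' i)`_b) (f a b).

(** Reduction modulo the ideal of the variables, that is, tensoring with [k]. *)
Definition coef0mx p q (M : 'M[S]_(p, q)) : 'M[k]_(p, q) := map_mx (mcoeff 0%MM) M.

(* [f] and [g] are the degree [i] terms of comparison maps; [R] is the part
   [fdiff F i.-1 *m h] of a homotopy from [f *m g] to the identity, of which only
   the properties needed to extend the homotopy are kept. *)
Definition comparison F F' i := exists f g R,
  [/\ graded_map f /\ (forall w, in_ker (w *m fdiff F i *m f)),
      forall w, in_ker (w *m fdiff F' i *m g),
      coef0mx R = 0, fdiff F i *m R = 0
    & forall w, in_ker (w *m (f *m g - 1%:M - R))].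

(** A lift [N] need not be graded, but truncating each entry to its expected degree preserves the
    equation, because [M] and [fdiff F' i] are homogeneous. *)
Lemma graded_mapP F F' i (N : 'M_(dim F i.+1, dim F' i.+1)) (M : 'M_(dim F i.+1, dim F' i)) :
    is_graded F' ->
    (forall (a : 'I_(dim F i.+1)) (c : 'I_(dim F' i)),
       homog_int ((fdeg F i.+1)`_a - (fdeg F' i)`_c) (M a c)) ->
    M = N *m fdiff F' i ->
  exists2 f : 'M_(dim F i.+1, dim F' i.+1), graded_map f & M = f *m fdiff F' i.
Proof.
move=> [grF' _] hM MN.
exists (\matrix_(a, b) hcomp ((fdeg F i.+1)`_a - (fdeg F' i.+1)`_b) (N a b)).
  by move=> a b; rewrite mxE; apply: homog_hcomp.
apply/matrixP => a c; rewrite -(hcomp_id (hM a c)) MN !mxE raddf_sum /=.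
apply: eq_bigr => b _; rewrite mxE (hcompMr _ _ (grF' i b c)); congr (hcomp _ _ * _).
by rewrite opprB addrA subrK.
Qed.

Lemma homog_mulmx F F' i (f : 'M_(dim F i, dim F' i)) :
  is_graded F -> graded_map f ->
  forall (a : 'I_(dim F i.+1)) (c : 'I_(dim F' i)),
    homog_int ((fdeg F i.+1)`_a - (fdeg F' i)`_c) ((fdiff F i *m f) a c).
Proof.
move=> [grF _] grf a c.
suff -> : (fdiff F i *m f) a c
    = hcomp ((fdeg F i.+1)`_a - (fdeg F' i)`_c) ((fdiff F i *m f) a c).
  exact: homog_hcomp.
rewrite mxE raddf_sum /=; apply: eq_bigr => b _; rewrite (hcompMl _ _ (grF i a b)).
rewrite (_ : _ - _ - _ = (fdeg F i)`_b - (fdeg F' i)`_c) ?hcomp_id //.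
by rewrite opprB addrC addrA subrK.
Qed.

Lemma comparison0_map F F' : is_graded F -> is_graded F' -> resolves F -> resolves F' ->
  exists f : 'M_(dim F 0, dim F' 0),
    graded_map f /\ forall w : 'rV_(dim F 0), I ((w *m f *m faug F') 0 0 - (w *m faug F) 0 0).
Proof.
move=> [_ gF] [_ gF'] _ [[v hv] _ _].
(* The vector [v] maps to 1 in the quotient by [I], so sending generator [a] to [faug F a 0] times
   [v] lifts the identity; [hcomp] makes this map graded. *)
exists (\matrix_(a, b) hcomp ((fdeg F 0)`_a - (fdeg F' 0)`_b) (faug F a 0 * v 0 b)).
split=> [a b|w]; first by rewrite mxE; apply: homog_hcomp.
set f := \matrix_(a, b) _.
have hf a : I ((f *m faug F') a 0 - faug F a 0).
  rewrite -[X in _ - X](hcomp_id (gF a)) mxE.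
  rewrite (eq_bigr (fun b => hcomp (fdeg F 0)`_a (faug F a 0 * v 0 b * faug F' b 0))).
    rewrite -raddf_sum -raddfB /=; apply: ideal_gen_hcomp => //.
    under eq_bigr do rewrite -mulrA.
    have -> : \sum_b faug F a 0 * (v 0 b * faug F' b 0) - faug F a 0
        = - faug F a 0 * (1 - (v *m faug F') 0 0).
      by rewrite -mulr_sumr mxE mulrBr mulr1 mulNr opprK addrC.
    exact: ideal_genM.
  by move=> b _; rewrite mxE (hcompMr _ _ (gF' b)).
rewrite -mulmxA !mxE -sumrB; under eq_bigr do rewrite -mulrBr.
exact: ideal_gen_sum.
Qed.

Lemma coef0mxM p q r (A : 'M[S]_(p, q)) (B : 'M_(q, r)) :
  coef0mx (A *m B) = coef0mx A *m coef0mx B.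
Proof. exact: map_mxM. Qed.

Lemma coef0mx_fdiff F i : is_minimal F -> coef0mx (fdiff F i) = 0.
Proof. by move=> mF; apply/matrixP => a b; rewrite !mxE; apply: mF. Qed.

Lemma comparison0 F F' : is_graded F -> is_graded F' -> resolves F -> resolves F' ->
  comparison F F' 0.
Proof.
move=> gF gF' rF rF'.
have [f [grf hf]] := comparison0_map gF gF' rF rF'.
have [g [_ hg]] := comparison0_map gF' gF rF' rF.
exists f, g, 0; split; rewrite ?mulmx0 //.
- split=> // w /=; have := hf (w *m fdiff F 0); have := in_ker_fdiff w rF.
  by move=> /= Iw Id; have := ideal_genD Id Iw; rewrite subrK.
- move=> w /=; have := hg (w *m fdiff F' 0); have := in_ker_fdiff w rF'.
  by move=> /= Iw Id; have := ideal_genD Id Iw; rewrite subrK.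
- exact: map_mx0.
move=> w /=; have := ideal_genD (hg (w *m f)) (hf w).
rewrite addrA subrK subr0 mulmxBr mulmx1 mulmxA mulmxBl.
by rewrite [X in _ -> I X]mxE [X in _ -> I (_ + X)]mxE.
Qed.

Lemma lift_map F F' i (f : 'M_(dim F i, dim F' i)) : resolves F' ->
    (forall w, in_ker (w *m fdiff F i *m f)) ->
  exists N, fdiff F i *m f = N *m fdiff F' i.
Proof.
move=> rF' h; apply: (@rowwise_lift _ _ _ _ (@in_ker F' i)) => [v /(exactP _ rF')//|a].
by rewrite row_mul rowE; apply: h.
Qed.

Lemma lift_map_ker F F' i (f : 'M_(dim F i, dim F' i)) f' : resolves F ->
    fdiff F i *m f = f' *m fdiff F' i ->
  forall w, @in_ker F' i.+1 (w *m fdiff F i.+1 *m f').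
Proof.
move=> rF e w /=; rewrite -!mulmxA -e (mulmxA (fdiff F i.+1)) fdiff_fdiff //.
by rewrite mul0mx mulmx0.
Qed.

(** By exactness [f *m g - 1 - R] factors as [h *m fdiff F i]. The new remainder [fdiff F i *m h]
    vanishes modulo the variables by minimality and is killed by the preceding differential, so the
    induction continues. *)
Lemma comparisonS F F' i : is_graded F -> is_graded F' -> resolves F -> resolves F' ->
  is_minimal F -> comparison F F' i -> comparison F F' i.+1.
Proof.
move=> gF gF' rF rF' mF [f [g [R [[grf hf] hg _ dR hR]]]].
have [N eN] := lift_map rF' hf.
have [f' grf' ef] := graded_mapP gF' (homog_mulmx gF grf) eN.
have [g' eg] := lift_map rF hg.
have [h eh] : exists h, f *m g - 1%:M - R = h *m fdiff F i.
  apply: (@rowwise_lift _ _ _ _ (@in_ker F i)) => [v /(exactP _ rF)//|a].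
  by rewrite rowE; apply: hR.
exists f', g', (fdiff F i *m h); split.
- by split=> //; apply: lift_map_ker ef.
- exact: lift_map_ker eg.
- by rewrite coef0mxM coef0mx_fdiff // mul0mx.
- by rewrite mulmxA fdiff_fdiff // mul0mx.
move=> w /=; rewrite -mulmxA !mulmxBl -(mulmxA f') -eg mulmxA -ef mul1mx -!mulmxA -eh.
by rewrite (mulmxBr (fdiff F i) _ R) dR subr0 (mulmxBr (fdiff F i)) mulmx1 subrr mulmx0.
Qed.

Lemma comparisonP F F' i : is_graded F -> is_graded F' -> resolves F -> resolves F' ->
  is_minimal F -> comparison F F' i.
Proof.
by move=> *; elim: i => [|i IH]; [apply: comparison0|apply: comparisonS].
Qed.

(** Modulo the variables both [R] and [h *m fdiff F i] vanish, so [f] gets a right inverse over [k].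
    A graded entry with a nonzero constant term joins generators of equal degree, so the block bound
    applies for each [j]. *)
Lemma leq_count_fdeg F F' i j :
    minimal_graded_resolution I F -> minimal_graded_resolution I F' ->
  (count_mem j (fdeg F i) <= count_mem j (fdeg F' i))%N.
Proof.
move=> [gF rF mF] [gF' rF' _].
have [f [g [R [[grf _] _ R0 _ hR]]]] := comparisonP i gF gF' rF rF' mF.
have [h eh] : exists h, f *m g - 1%:M - R = h *m fdiff F i.
  apply: (@rowwise_lift _ _ _ _ (@in_ker F i)) => [v /(exactP _ rF)//|a].
  by rewrite rowE; apply: hR.
have fg1 : coef0mx f *m coef0mx g = 1%:M.
  have := congr1 (@coef0mx _ _) eh; rewrite coef0mxM coef0mx_fdiff // mulmx0.
  rewrite /coef0mx !map_mxB -/(coef0mx R) R0 subr0 map_mx1 map_mxM.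
  by move/eqP; rewrite subr_eq0 => /eqP.
have card_count H : count_mem j (fdeg H i) =
    #|[pred a : 'I_(dim H i) | (fdeg H i)`_a == j]|.
  by rewrite -sum1_count (big_nth 0) big_mkord sum1_card.
rewrite !card_count; 
apply: (@leq_card_support_mulmx1 _ _ _ _ (fun a : 'I_(dim F i) => (fdeg F i)`_a)
  (fun b : 'I_(dim F' i) => (fdeg F' i)`_b) _ _ j fg1) => a b.
by rewrite mxE => /(homog_int_coef0 (grf a b))/eqP; rewrite subr_eq0 => /eqP.
Qed.

(** The resolution [F] shows that the choice made by [epsilon] is itself minimal; the inequality is
    then used in both directions. *)
Lemma graded_betti_eq F i j : minimal_graded_resolution I F ->
  graded_betti I i j = count_mem j (fdeg F i).
Proof.
move=> mF; have mm : minimal_graded_resolution I (min_res I).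
  by apply: epsilon_spec; exists F.
by apply/eqP; rewrite eqn_leq !leq_count_fdeg.
Qed.

Lemma total_betti_eq F i : minimal_graded_resolution I F ->
  total_betti I i = size (fdeg F i).
Proof.
move=> mF; rewrite /total_betti.
have pe : perm_eq (fdeg (min_res I) i) (fdeg F i).
  by apply/allP => j _ /=; apply/eqP; apply: (graded_betti_eq i j mF).
rewrite -(perm_size pe) -[RHS](perm_size (perm_count_undup _)) size_flatten sumnE.
rewrite /shape !big_map; apply: eq_bigr => j _; by rewrite size_nseq.
Qed.

End Uniqueness.

(** * Free sequences with bases indexed by lists of labels *)

Section BasedSequence.
Variables (k : fieldType) (m : nat) (T : eqType) (t0 : T).
Local Notation S := {mpoly k[m]}.
Variables (bs : nat -> seq T) (deg : nat -> T -> int) (D : nat -> T -> T -> S) (aug : T -> S).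
Hypothesis bs_uniq : forall i, uniq (bs i).

Definition based_seq : free_seq k m :=
  @FreeSeq k m (fun i => [seq deg i t | t <- bs i])
    (fun i => \matrix_(a, b) D i (nth t0 (bs i.+1) a) (nth t0 (bs i) b))
    (\col_a aug (nth t0 (bs 0) a)).

Local Notation dim i := (size [seq deg i t | t <- bs i]).

(** Row vectors are traded for coefficient functions on labels, so that exactness can be proved
    without matrix indices. Outside the basis [fun_of] takes the default value 0. *)
Let row_of i (c : T -> S) : 'rV[S]_(dim i) := \row_a c (nth t0 (bs i) a).
Let fun_of i (v : 'rV[S]_(dim i)) (t : T) : S :=
  if insub (index t (bs i)) is Some a then v 0 a else 0.

Let ltdim i (a : 'I_(dim i)) : (a < size (bs i))%N.
Proof. exact: leq_trans (ltn_ord a) (eq_leq (size_map _ _)). Qed.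

Let fun_ofE i v (a : 'I_(dim i)) : fun_of v (nth t0 (bs i) a) = v 0 a.
Proof. by rewrite /fun_of index_uniq // valK. Qed.

Let row_ofK i (v : 'rV[S]_(dim i)) : row_of i (fun_of v) = v.
Proof. by apply/rowP => a; rewrite mxE fun_ofE. Qed.

Let eq_row_of i c c' : row_of i c = row_of i c' <-> {in bs i, c =1 c'}.
Proof.
split=> [/rowP e t tb|e]; last first.
  by apply/rowP => a; rewrite !mxE; apply/e/mem_nth/ltdim.
have lt : (index t (bs i) < dim i)%N by rewrite size_map index_mem.
by have := e (Ordinal lt); rewrite !mxE nth_index.
Qed.

Let sum_dim i (F : T -> S) : \sum_(a < dim i) F (nth t0 (bs i) a) = \sum_(t <- bs i) F t.
Proof. by rewrite [RHS](big_nth t0) big_mkord size_map. Qed.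

Let row_of_diff i c : row_of i.+1 c *m fdiff based_seq i =
  row_of i (fun t => \sum_(s <- bs i.+1) c s * D i s t).
Proof.
apply/rowP => b; rewrite !mxE -sum_dim; apply: eq_bigr => a _.
by rewrite !mxE.
Qed.

Let row_of_aug c : (row_of 0 c *m faug based_seq) 0 0 = \sum_(t <- bs 0) c t * aug t.
Proof. by rewrite !mxE -sum_dim; apply: eq_bigr => a _; rewrite !mxE. Qed.

Lemma based_resolution (I : S -> Prop) :
    (exists c, I (1 - \sum_(t <- bs 0) c t * aug t)) ->
    (forall c, I (\sum_(t <- bs 0) c t * aug t) <->
       exists e, {in bs 0, forall t, c t = \sum_(s <- bs 1) e s * D 0 s t}) ->
    (forall i c, {in bs i, forall t, \sum_(s <- bs i.+1) c s * D i s t = 0} <->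
       exists e, {in bs i.+1, forall s, c s = \sum_(r <- bs i.+2) e r * D i.+1 r s}) ->
  is_resolution I based_seq.
Proof.
move=> h0 h1 h2.
have im i c : (exists w, row_of i c = w *m fdiff based_seq i) <->
    exists e, {in bs i, forall t, c t = \sum_(s <- bs i.+1) e s * D i s t}.
  split=> [[w]|[e he]].
    rewrite -[w]row_ofK row_of_diff => /eq_row_of h; by exists (fun_of w).
  by exists (row_of i.+1 e); rewrite row_of_diff; apply/eq_row_of.
split.
- by case: h0 => c; rewrite -row_of_aug; exists (row_of 0 c).
- by move=> v; rewrite -[v]row_ofK row_of_aug; apply: iff_trans (h1 _) (iff_sym (im _ _)).
move=> i v; rewrite -[v]row_ofK row_of_diff.
apply: iff_trans (iff_sym (im _ _)); apply: iff_trans (h2 i _).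
have -> : 0 = row_of i (fun=> 0) by apply/rowP => a; rewrite !mxE.
exact: eq_row_of.
Qed.

Lemma based_graded :
    (forall i, {in bs i.+1 & bs i, forall s t, homog_int (deg i.+1 s - deg i t) (D i s t)}) ->
    {in bs 0, forall t, homog_int (deg 0 t) (aug t)} ->
  is_graded based_seq.
Proof.
move=> h h0; split=> [i a b|a]; rewrite mxE !(nth_map t0) ?ltdim //.
  by apply: h; apply/mem_nth/ltdim.
by apply/h0/mem_nth/ltdim.
Qed.

Lemma based_minimal :
    (forall i, {in bs i.+1 & bs i, forall s t, (D i s t)@_0%MM = 0}) ->
  is_minimal based_seq.
Proof. by move=> h i a b; rewrite mxE; apply: h; apply/mem_nth/ltdim. Qed.

End BasedSequence.

(** * The Taylor resolution of a monomial ideal *)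

Section Taylor.
Variables (k : fieldType) (m n : nat) (mon : 'I_n -> 'X_{1..m}).
Local Notation S := {mpoly k[m]}.
Implicit Types (s t : 'I_n) (A B : {set 'I_n}) (C : {set 'I_n} -> S) (a : 'X_{1..m}).

Definition set_lcm A : 'X_{1..m} := [multinom (\max_(s in A) mon s i)%N | i < m].

Lemma set_lcmP A a : reflect {in A, forall s, (mon s <= a)%MM} (set_lcm A <= a)%MM.
Proof.
apply: (iffP mnm_lepP) => [h s sA|h i].
  apply/mnm_lepP => i; apply: leq_trans (h i); rewrite mnmE.
  by rewrite (bigD1 s) //= leq_maxl.
by rewrite mnmE; apply/bigmax_leqP => s /h/mnm_lepP.
Qed.

Lemma set_lcmS A B : A \subset B -> (set_lcm A <= set_lcm B)%MM.
Proof. by move=> sAB; apply/set_lcmP => s /(subsetP sAB); apply/set_lcmP/lepm_refl. Qed.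

Lemma set_lcm0 : set_lcm set0 = 0%MM.
Proof. by apply/mnmP => i; rewrite !mnmE big_set0. Qed.

Lemma set_lcm1 s : set_lcm [set s] = mon s.
Proof. by apply/mnmP => i; rewrite !mnmE big_set1. Qed.

(** The usual incidence sign: the exponent is the position that [s] takes among the elements of
    [A]. *)
Definition set_sign (R : pzRingType) s A : R := (-1) ^+ #|[set t in A | (t < s)%N]|.

(** The simplicial boundary of the chain [C] read off at the face [A]: contributions come from the
    sets with one more element. Chains of all dimensions are treated at once. *)
Definition boundary C A : S := \sum_(s | s \notin A) set_sign k s A *: C (s |: A).

Lemma set_signU1 s t A : t \notin A -> s != t ->
  set_sign k s (t |: A) = (if (t < s)%N then -1 else 1) * set_sign k s A.
Proof.
move=> tA st; rewrite /set_sign.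
have -> : [set u in t |: A | (u < s)%N] =
    if (t < s)%N then t |: [set u in A | (u < s)%N] else [set u in A | (u < s)%N].
  apply/setP => u; case: ifP => ts; rewrite !inE.
    by case: eqP => [->|] //=; rewrite ts.
  by case: eqP => [->|] //=; rewrite ts (negbTE tA).
case: ifP => _; last by rewrite mul1r.
by rewrite cardsU1 inE (negbTE tA) exprS.
Qed.

Lemma boundaryK C A : boundary (boundary C) A = 0.
Proof.
rewrite /boundary.
pose f s t := set_sign k s A * set_sign k t (s |: A) *: C (t |: (s |: A)).
have -> : \sum_(s | s \notin A) set_sign k s A *:
      (\sum_(t | t \notin s |: A) set_sign k t (s |: A) *: C (t |: (s |: A))) =
    \sum_s \sum_(t | [&& s \notin A, t \notin A & s != t]) f s t.
  rewrite big_mkcond; apply: eq_bigr => s _; case: ifP => [sA|_]; last by rewrite big_pred0.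
  rewrite scaler_sumr; apply: eq_big => [t|t _]; last by rewrite scalerA.
  by rewrite !inE negb_or eq_sym andbC.
have fN s t : s \notin A -> t \notin A -> s != t -> f t s = - f s t.
  move=> sA tA st; rewrite /f setUCA -scaleNr; congr (_ *: _).
  rewrite !set_signU1 // 1?eq_sym //.
  case: (ltngtP s t) => [lt|lt|/val_inj e]; last by rewrite e eqxx in st.
    by rewrite !mulN1r mul1r mulrN opprK mulrC.
  by rewrite !mulN1r mul1r mulrN mulrC.
(* The double sum is split by the order of [s] and [t]; exchanging the two names in one half makes
   it the opposite of the other. *)
rewrite (eq_bigr (fun s => \sum_(t | [&& s \notin A, t \notin A & (s < t)%N]) f s t +
    \sum_(t | [&& s \notin A, t \notin A & (t < s)%N]) f s t)); last first.
  move=> s _; rewrite (bigID (fun t => (s < t)%N)) /=.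
  congr (_ + _); apply: eq_bigl => t; rewrite -!andbA; congr (_ && (_ && _));
    rewrite -val_eqE /=; lia.
rewrite big_split /= addrC (exchange_big_dep predT) //= -big_split big1 //= => s _.
rewrite -[X in _ + X]opprK; apply/eqP; rewrite subr_eq0 -sumrN; apply/eqP.
apply: eq_big => [t|t /and3P[tA sA lt]]; first by rewrite andbCA.
by rewrite fN // -val_eqE /=; lia.
Qed.

(* [s] is the first index whose monomial divides ['X_[a]]. *)
Definition first_div s a := (mon s <= a)%MM && [forall t, (mon t <= a)%MM ==> (s <= t)%N].

Definition cone C A : S := \sum_(s in A) mfilter (first_div s) (C (A :\ s)).

Lemma first_divP a s : (mon s <= a)%MM -> exists s0, forall t, first_div t a = (t == s0).
Proof.
move=> sa; have [s0 s0a min0] := @arg_minnP _ s (fun t => mon t <= a)%MM (fun t => t : nat) sa.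
exists s0 => t; apply/andP/eqP => [[ta /forallP h]|->].
  apply/val_inj/anti_leq; rewrite min0 // andbT.
  by have := h s0; rewrite s0a.
by split=> //; apply/forallP => u; apply/implyP/min0.
Qed.

Lemma mcoeff_cone C A a s0 : (forall t, first_div t a = (t == s0)) ->
  (cone C A)@_a = if s0 \in A then (C (A :\ s0))@_a else 0.
Proof.
move=> h; rewrite raddf_sum /= big_mkcond (bigD1 s0) //= mcoeff_filter h eqxx.
rewrite big1 ?addr0 // => t /negbTE ne.
by rewrite mcoeff_filter h ne if_same.
Qed.

(** These chains model the Taylor complex: multiplying the coefficient at [A] by the lcm monomial of
    [A] turns the Taylor differential into the plain [boundary]. *)
Definition lcm_supported C := forall A a, (C A)@_a != 0 -> (set_lcm A <= a)%MM.

Lemma cone_supported C : lcm_supported C -> lcm_supported (cone C).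
Proof.
move=> hC A a; have [/existsP[s sa]|] := boolP [exists s, mon s <= a]%MM.
  have [s0 h0] := first_divP sa; rewrite (mcoeff_cone _ _ h0).
  case: ifP => s0A; last by rewrite eqxx.
  move/hC/set_lcmP => h; apply/set_lcmP => t tA.
  have [->|ne] := eqVneq t s0; last by apply: h; rewrite !inE ne.
  by have := h0 s0; rewrite eqxx => /andP[].
rewrite negb_exists => /forallP h; rewrite raddf_sum big1 ?eqxx //= => t _.
by rewrite mcoeff_filter /first_div (negbTE (h t)).
Qed.

Lemma set_sign_le s A : {in A, forall t, (s <= t)%N} -> set_sign k s A = 1.
Proof.
move=> h; rewrite /set_sign (_ : [set t in A | _] = set0) ?cards0 //.
apply/setP => t; rewrite !inE; case: (boolP (t \in A)) => //= /h; lia.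
Qed.

(* [cone] is a contracting homotopy: adjoining the first divisor of each
   monomial contracts the simplex of its divisors. *)
Lemma boundary_cone C A : lcm_supported C -> A != set0 ->
  boundary (cone C) A + cone (boundary C) A = C A.
Proof.
move=> hC /set0Pn[u uA]; apply/mpolyP => a; rewrite mcoeffD raddf_sum /=.
under eq_bigr do rewrite mcoeffZ.
(* If no generator divides the monomial [a], both cones vanish at [a], and so does [C A] because [A]
   is nonempty. *)
have [/existsP[s sa]|] := boolP [exists s, mon s <= a]%MM; last first.
  rewrite negb_exists => /forallP h.
  have cone0 C' B : (cone C' B)@_a = 0.
    rewrite raddf_sum big1 //= => t _.
    by rewrite mcoeff_filter /first_div (negbTE (h t)).
  rewrite cone0 addr0 big1 => [|t _]; last by rewrite cone0 mulr0.
  apply/esym/eqP; apply: contraT => /hC/set_lcmP/(_ _ uA).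
  by rewrite (negbTE (h u)).
have [s0 h0] := first_divP sa; rewrite (mcoeff_cone _ _ h0).
under eq_bigr do rewrite (mcoeff_cone _ _ h0).
have /andP[s0a /forallP min0] : first_div s0 a by rewrite h0.
(* If [C B] has a nonzero coefficient at [a], every generator in [B] divides [a]; hence [s0] comes
   before all other elements of [B] and its sign is 1. *)
have sgn1 B B' : B' \subset B -> set_sign k s0 B' * (C B)@_a = (C B)@_a.
  move=> sBB; have [->|/hC/set_lcmP h] := eqVneq (C B)@_a 0; first by rewrite mulr0.
  rewrite set_sign_le ?mul1r // => t /(subsetP sBB)/h ta.
  by have := min0 t; rewrite ta.
case: ifPn => s0A; last first.
  rewrite addr0 (bigD1 s0) //= setU11 setU1K // sgn1 // big1 ?addr0 // => t /andP[_ ne].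
  by rewrite !inE (negbTE s0A) eq_sym (negbTE ne) mulr0.
(* With [s0] in [A], the summand [s0] of the inner boundary is [C A]. The other summands cancel in
   pairs, since removing [s0 < t] from the set flips the sign of [t]. *)
rewrite [boundary C _]/boundary raddf_sum [X in _ + X](bigD1 s0) ?setD11 //=.
rewrite mcoeffZ setD1K // sgn1 ?subD1set //.
rewrite addrCA; rewrite -[RHS]addr0; congr (_ + _).
rewrite [X in _ + X](eq_bigl (fun t => t \notin A)) => [|t]; last first.
  by rewrite !inE; case: eqP => [->|_]; rewrite /= ?andbT ?s0A.
rewrite -big_split big1 //= => t tA.
have ne : t != s0 by apply: contraNneq tA => ->.
rewrite mcoeffZ inE s0A orbT (_ : (t |: A) :\ s0 = t |: A :\ s0); last first.
  by apply/setP => v; rewrite !inE; case: (eqVneq v t) => [->|] //; rewrite ne.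
rewrite -mulrDl; have [->|/hC/set_lcmP h] := eqVneq (C (t |: A :\ s0))@_a 0.
  by rewrite mulr0.
have lt : (s0 < t)%N.
  rewrite ltn_neqAle (inj_eq val_inj) eq_sym ne /=.
  by have := min0 t; rewrite h ?setU11.
by rewrite -{1}(setD1K s0A) set_signU1 ?setD11 // lt mulN1r addNr mul0r.
Qed.

Definition taylor_basis i : seq {set 'I_n} := enum [set A : {set 'I_n} | #|A| == i].

Lemma mem_taylor_basis i A : (A \in taylor_basis i) = (#|A| == i).
Proof. by rewrite mem_enum inE. Qed.

(** The sum has one term when [B] is a facet of [A] and is empty otherwise, so the truncated
    difference of exponents matters only when it is a true quotient of lcms. *)
Definition taylor_diff A B : S :=
  (\sum_(s in A | A :\ s == B) set_sign k s B) *: 'X_[set_lcm A - set_lcm B].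

Definition taylor_seq : free_seq k m :=
  based_seq set0 taylor_basis (fun=> fun A => (mdeg (set_lcm A))%:Z)
    (fun=> taylor_diff) (fun=> 1).

Lemma taylor_diffE i (c : {set 'I_n} -> S) B : #|B| = i ->
  (\sum_(A <- taylor_basis i.+1) c A * taylor_diff A B) * 'X_[set_lcm B] =
  boundary (fun A => c A * 'X_[set_lcm A]) B.
Proof.
move=> cB; rewrite /taylor_basis big_enum /= mulr_suml.
rewrite (eq_bigr (fun A => \sum_(s in A | A :\ s == B)
    set_sign k s B *: (c A * 'X_[set_lcm A]))); last first.
  move=> A _; rewrite -scaler_suml /taylor_diff -scalerAr -scalerAl -mulrA -mpolyXD.
  have [e|nz] := eqVneq (\sum_(s in A | A :\ s == B) set_sign k s B) 0.
    by rewrite e !scale0r.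
  rewrite submK //; apply: contraNT nz => nle; rewrite big_pred0 // => s.
  by apply: contraNF nle => /andP[_ /eqP <-]; apply/set_lcmS/subD1set.
rewrite (exchange_big_dep predT) //= /boundary [RHS]big_mkcond; apply: eq_bigr => s _.
case: ifPn => sB.
  rewrite (big_pred1 (s |: B)) // => A; rewrite !inE.
  apply/and3P/eqP => [[_ sA /eqP <-]|->]; first by rewrite setD1K.
  by rewrite setU11 setU1K // cardsU1 sB cB.
by rewrite big_pred0 // => A; apply: contraNF sB => /and3P[_ _ /eqP <-]; rewrite setD11.
Qed.

(** Exponents are subtracted with truncation, so this is a true quotient only when [b] divides every
    monomial of [p]. *)
Definition mon_div (b : 'X_{1..m}) (p : S) : S := \sum_(a <- msupp p) p@_a *: 'X_[a - b].

Lemma mon_divK (b : 'X_{1..m}) (p : S) : (forall a, p@_a != 0 -> (b <= a)%MM) ->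
  mon_div b p * 'X_[b] = p.
Proof.
move=> h; rewrite mulr_suml [RHS]mpolyE; apply: eq_big_seq => a.
by rewrite mcoeff_msupp => /h ba; rewrite -scalerAl -mpolyXD submK.
Qed.

Lemma mcoeffMX_neq0 (b a : 'X_{1..m}) (p : S) : (p * 'X_[b])@_a != 0 -> (b <= a)%MM.
Proof.
rewrite -mcoeff_msupp (perm_mem (msuppMX _ _)) => /mapP[c _ ->].
exact: lem_addr.
Qed.

Lemma lcm_supportedM (c : {set 'I_n} -> S) : lcm_supported (fun A => c A * 'X_[set_lcm A]).
Proof. by move=> A a /mcoeffMX_neq0. Qed.

Lemma mulIX (b : 'X_{1..m}) : injective ( *%R^~ ('X_[b] : S)).
Proof.
apply: mulIf; apply/eqP => /(congr1 (mcoeff b)); rewrite mcoeffX eqxx mcoeff0.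
exact/eqP/oner_neq0.
Qed.

Lemma eq_boundary C C' A : (forall s, s \notin A -> C (s |: A) = C' (s |: A)) ->
  boundary C A = boundary C' A.
Proof. by move=> h; apply: eq_bigr => s /h ->. Qed.

(** For a cycle, the homotopy formula reduces to [boundary (cone C) A = C A]. The cone is again
    divisible by the lcms, and dividing them out gives the preimage. *)
Lemma taylor_exact i (c : {set 'I_n} -> S) :
    {in taylor_basis i, forall B, \sum_(A <- taylor_basis i.+1) c A * taylor_diff A B = 0} <->
  exists e, {in taylor_basis i.+1, forall A,
    c A = \sum_(A' <- taylor_basis i.+2) e A' * taylor_diff A' A}.
Proof.
split=> [h|[e he] B]; last first.
  rewrite mem_taylor_basis => /eqP cB; apply/(mulIX (b := set_lcm B)).
  rewrite mul0r taylor_diffE // -[RHS](boundaryK (fun A => e A * 'X_[set_lcm A]) B).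
  apply: eq_boundary => s sB; have cA : #|s |: B| = i.+1 by rewrite cardsU1 sB cB.
  by rewrite -(taylor_diffE _ cA) he // mem_taylor_basis cA.
pose C A := c A * 'X_[set_lcm A]; have sC : lcm_supported C by apply: lcm_supportedM.
exists (fun A => mon_div (set_lcm A) (cone C A)) => A.
rewrite mem_taylor_basis => /eqP cA; apply/(mulIX (b := set_lcm A)).
rewrite taylor_diffE // -/(C A) -(boundary_cone sC); last by rewrite -card_gt0 cA.
rewrite [X in _ + X]big1 ?addr0 => [|s sA]; last first.
  have cB : #|A :\ s| = i by have := cardsD1 s A; rewrite sA cA => -[].
  by rewrite -(taylor_diffE _ cB) h ?mul0r ?raddf0 // mem_taylor_basis cB.
by apply: eq_boundary => s _; rewrite mon_divK //; apply: cone_supported.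
Qed.

Variable G : S -> Prop.
Hypothesis GP : forall p, G p <-> exists s, p = 'X_[mon s].

Lemma mem_monomial_ideal p :
  ideal_gen G p <-> exists f : 'I_n -> S, p = \sum_s f s * 'X_[mon s].
Proof.
split=> [[r [c [g [Gg ->]]]]|[f ->]]; last first.
  by apply: ideal_gen_sum => s; apply/ideal_gen_mem/GP; exists s.
apply: (big_ind (fun q => exists f : 'I_n -> S, q = \sum_s f s * 'X_[mon s])).
- by exists (fun=> 0); rewrite big1 // => s _; rewrite mul0r.
- move=> _ _ [f ->] [f' ->]; exists (fun s => f s + f' s).
  by rewrite -big_split; apply: eq_bigr => s _; rewrite mulrDl.
move=> j _; have [s ->] := iffLR (GP _) (Gg j).
exists (fun t => if t == s then c j else 0); rewrite (bigD1 s) //= eqxx big1 ?addr0 //.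
by move=> t /negbTE ->; rewrite mul0r.
Qed.

Lemma taylor_basis0 : taylor_basis 0 = [:: set0].
Proof.
by rewrite /taylor_basis (_ : [set A | _] = [set set0]) ?enum_set1 //;
  apply/setP => A; rewrite !inE cards_eq0.
Qed.

Lemma taylor_resolution : is_resolution (ideal_gen G) taylor_seq.
Proof.
apply: based_resolution => [i|||i c]; [exact: enum_uniq| | |exact: taylor_exact].
  by exists (fun=> 1); rewrite taylor_basis0 big_seq1 mulr1 subrr; apply: ideal_gen0.
move=> c; rewrite taylor_basis0 big_seq1 mulr1; apply: iff_trans (mem_monomial_ideal _) _.
have e (f : {set 'I_n} -> S) :
    \sum_(A <- taylor_basis 1) f A * taylor_diff A set0 =
    \sum_s f [set s] * 'X_[mon s].
  have := taylor_diffE f (cards0 _); rewrite set_lcm0 mpolyX0 mulr1 => ->.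
  apply: eq_big => [s|s _]; first by rewrite inE.
  by rewrite setU0 set_lcm1 set_sign_le ?scale1r // => t; rewrite inE.
split=> [[f cf]|[f /(_ set0)]]; last first.
  by rewrite mem_seq1 eqxx => /(_ isT) ->; exists (fun s => f [set s]); rewrite e.
exists (fun A => if [pick s in A] is Some s then f s else 0) => A.
rewrite mem_seq1 => /eqP ->; rewrite e cf; apply: eq_bigr => s _.
by case: pickP => [t|/(_ s)]; rewrite inE ?eqxx // => /eqP ->.
Qed.

Lemma mcoeff_taylor_diff A B a : (taylor_diff A B)@_a != 0 ->
  B \subset A /\ a = (set_lcm A - set_lcm B)%MM.
Proof.
rewrite mcoeffZ mcoeffX mulf_eq0 negb_or => /andP[nz].
have [<- _|_] := eqVneq (set_lcm A - set_lcm B)%MM a; last by rewrite eqxx.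
split=> //; apply: contraNT nz => nle; rewrite big_pred0 // => s.
by apply: contraNF nle => /andP[_ /eqP <-]; apply: subD1set.
Qed.

(** A nonzero constant term in the entry from [A] to [B] would force [A] and its proper subset [B]
    to have the same lcm, hence also [A] and some [A :\ s]. *)
Lemma taylor_minimal_resolution :
    (forall s A, s \in A -> set_lcm (A :\ s) != set_lcm A) ->
  minimal_graded_resolution (ideal_gen G) taylor_seq.
Proof.
move=> strict; split; last first.
- apply: based_minimal => i A B; rewrite !mem_taylor_basis => /eqP cA /eqP cB.
  apply/eqP; apply: contraT => /mcoeff_taylor_diff[sBA e].
  have pBA : B \proper A by rewrite properEcard sBA cA cB /=.
  have /properP[_ [s sA sB]] := pBA.
  have sD : B \subset A :\ s by rewrite subsetD1 sBA.
  case/negP: (strict s A sA); apply/eqP/mnmP => j; apply/anti_leq.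
  rewrite (mnm_lepP (set_lcmS (subD1set A s))) /=.
  have := congr1 (fun x : 'X_{1..m} => x j) e; rewrite mnm0E mnmBE => /esym/eqP.
  rewrite subn_eq0 => /leq_trans; apply; exact: mnm_lepP (set_lcmS sD) j.
- exact: taylor_resolution.
apply: based_graded => [i A B _ _|A]; last first.
  rewrite taylor_basis0 mem_seq1 => /eqP ->; rewrite set_lcm0 mdeg0.
  exact: dhomog1.
apply/homog_intP => a /mcoeff_taylor_diff[/set_lcmS le ->].
by have := congr1 (@mdeg m) (submK le); rewrite mdegD; lia.
Qed.

End Taylor.

(** * Saturated chains in a finite poset *)

Section SaturatedChains.
Variables (d : Order.disp_t) (P : finPOrderType d).
Implicit Types (c : seq P) (x y : P).
Local Open Scope order_scope.

Lemma covers_lt x y : covers x y -> x < y.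
Proof. by case/andP. Qed.

Lemma saturated_lt_sorted c : saturated_chain c -> sorted <%O c.
Proof. exact/sub_sorted/covers_lt. Qed.

Lemma saturated_uniq c : saturated_chain c -> uniq c.
Proof. by move/saturated_lt_sorted; apply: lt_sorted_uniq. Qed.

Lemma saturated_comparable c : saturated_chain c -> {in c &, forall x y, x >=< y}.
Proof.
move=> /saturated_lt_sorted sc x y xc yc.
case: (ltngtP (index x c) (index y c)) => [lt|lt|e].
- by apply: lt_comparable; apply: sorted_ltn_index lt => //; apply: lt_trans.
- by apply: gt_comparable; apply: sorted_ltn_index lt => //; apply: lt_trans.
by rewrite -(nth_index x xc) e nth_index // comparablexx.
Qed.

(** Two members of a chain in a cover relation have nothing between them, so they are consecutive.
    The edges of a saturated chain thus depend only on its set of elements. *)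
Lemma mem_zip_saturated c : saturated_chain c ->
  forall x y, ((x, y) \in zip c (behead c)) = [&& x \in c, y \in c & covers x y].
Proof.
elim: c => // a [|b c] IH /= sc x y.
  by rewrite in_nil !mem_seq1; case: eqP => //= ->; case: eqP => //= ->; rewrite /covers ltxx.
have /andP[ab sc'] := sc; have {}IH := IH sc'.
have lt_a : {in b :: c, forall z, a < z}.
  exact/allP/(order_path_min lt_trans)/(@saturated_lt_sorted [:: a, b & c] sc).
have le_b : {in b :: c, forall z, b <= z}.
  have /(order_path_min lt_trans)/allP h : path <%O b c := @saturated_lt_sorted (b :: c) sc'.
  by move=> z; rewrite inE => /predU1P[->//|/h/ltW].
rewrite in_cons IH xpair_eqE !(in_cons a).
have [->|xa] := eqVneq x a; have [->|ya] := eqVneq y a => /=.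
- rewrite /covers ltxx !andbF orbF; apply: contraTF ab => /eqP ->.
  by rewrite /covers ltxx.
- have -> : (a \in b :: c) = false.
    by apply: contraTF isT => /lt_a; rewrite ltxx.
  rewrite orbF; apply/eqP/andP => [->|[yc /andP[_ /existsP nz]]].
    by rewrite mem_head.
  apply/eqP; apply: contraT => yb; case: nz; exists b.
  by rewrite (covers_lt ab) lt_neqAle le_b // eq_sym yb.
- rewrite [a \in b :: c]negbTE ?andbF //=; last first.
    by apply/negP => /lt_a; rewrite ltxx.
  apply/esym/negbTE; rewrite negb_and orbC; apply/orP.
  have [xc|] := boolP (x \in b :: c); last by right.
  by left; apply/negP => /covers_lt/(lt_trans (lt_a _ xc)); rewrite ltxx.
- by [].
Qed.

End SaturatedChains.

(** * Maximal chains of the ladder with [n.+1] columns *)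

Section Ladder.
Variable n : nat.
Local Notation L := (L2 n.+1).
Implicit Types (s : 'I_n.+1) (v : L).

(** The climb at column [s] takes one step, so later positions [j] lie in column [j.-1]; all
    arguments of [inord] are in range. *)
Definition ladder_path s : seq L :=
  mkseq (fun j => if (j <= s)%N then (ord0, inord j) else (ord_max, inord j.-1)) n.+2.

Definition on_path (s : nat) v : bool := if v.1 == ord0 then (v.2 <= s)%N else (s <= v.2)%N.

Lemma mem_ladder_path s v : (v \in ladder_path s) = on_path s v.
Proof.
have sn := ltn_ord s; apply/mapP/idP => [[j]|].
  rewrite mem_iota add0n => /= jn ->; rewrite /on_path.
  by have [js|js] := leqP j s; rewrite /= inordK //; lia.
case: v => a t; rewrite /on_path; have tn := ltn_ord t; case: ifP => [/eqP /= ->|/= a0] /= h.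
  exists (val t); first by rewrite (mem_iota 0 n.+2) (leq_trans tn).
  by rewrite h inord_val.
exists t.+1; first by rewrite (mem_iota 0 n.+2).
rewrite ltnNge h /= inord_val; congr (_, _); apply/val_inj => /=.
by have := ltn_ord a; move/negbT: a0; rewrite -val_eqE /=; lia.
Qed.

Lemma ladder_path_saturated s : saturated_chain (ladder_path s).
Proof.
have sn := ltn_ord s.
apply/(sortedP (ord0, ord0)) => j; rewrite size_mkseq => jn.
rewrite !nth_mkseq ?(ltnW jn) // L2_coversE.
case: (ltngtP j s) => js; [|have := js|]; rewrite /= ?inordK //; lia.
Qed.

Lemma size_ladder_path s : size (ladder_path s) = n.+2.
Proof. exact: size_mkseq. Qed.

Lemma saturated_sub_ladder_path (c : seq L) : saturated_chain c ->
  exists s, {subset c <= ladder_path s}.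
Proof.
(* The climb is placed at the last column that the chain visits in row 0, or at column 0 if it
   visits none; comparability puts its row 1 elements at or after that column. *)
move=> sc; pose s := (\max_(v <- c | v.1 == ord0) v.2)%N.
have sn : (s < n.+1)%N by rewrite ltnS; apply/bigmax_leqP_seq => v _ _; rewrite -ltnS.
exists (Ordinal sn) => v vc; rewrite mem_ladder_path /on_path; case: ifP => v0.
  exact: (@leq_bigmax_seq _ c (fun u : L => u.1 == ord0) (fun u : L => val u.2) v vc v0).
apply/bigmax_leqP_seq => u uc u0; have := saturated_comparable sc uc vc.
move/negbT: v0 (eqP u0); rewrite -val_eqE /= => v0 u0'.
by rewrite /Order.comparable !L2_leE u0' /=; lia.
Qed.

Lemma saturated_leq_size (c : seq L) : saturated_chain c -> (size c <= n.+2)%N.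
Proof.
move=> sc; have [s /(uniq_leq_size (saturated_uniq sc))] := saturated_sub_ladder_path sc.
by rewrite size_ladder_path.
Qed.

Lemma saturated_size_perm (c : seq L) : saturated_chain c -> size c = n.+2 ->
  exists s, perm_eq c (ladder_path s).
Proof.
move=> sc cn; have [s sub] := saturated_sub_ladder_path sc; exists s.
have us := saturated_uniq (ladder_path_saturated s).
apply: uniq_perm => //; first exact: saturated_uniq.
by have [|//] := uniq_min_size (saturated_uniq sc) sub; rewrite cn size_ladder_path.
Qed.

Lemma maximal_saturated_chain_ladder (c : seq L) : maximal_saturated_chain c ->
  saturated_chain c /\ exists s, c =i ladder_path s.
Proof.
case=> sc maxc; split=> //; have [s sub] := saturated_sub_ladder_path sc; exists s => v.
by apply/idP/idP; [apply: sub|apply/maxc/sub/ladder_path_saturated].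
Qed.

Lemma ladder_path_maximal s : maximal_saturated_chain (ladder_path s).
Proof.
split=> [|c sc sub v vc]; first exact: ladder_path_saturated.
have us := saturated_uniq (ladder_path_saturated s).
have [|_ e] := uniq_min_size us sub; last by rewrite e.
by rewrite size_ladder_path saturated_leq_size.
Qed.

End Ladder.

(** * The edge ideal: degrees of lcms and their enumeration *)

Section LatticeDiagramIdeal.
Variables (k : fieldType) (n : nat).
Local Notation L := (L2 n.+1).
Local Notation m := (3 * n.+1 - 2)%N.
Implicit Types (s t : 'I_n.+1) (A : {set 'I_n.+1}).

Definition on_edge s (e : hasse_edge L) : bool := on_path s (val e).1 && on_path s (val e).2.

Definition ld_mon s : 'X_{1..m} := (\sum_(e | on_edge s e) U_(edge_var e))%MM.

Lemma edge_monomialE (c : seq L) s : saturated_chain c -> c =i ladder_path s ->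
  edge_monomial k (@edge_var n.+1) c = 'X_[ld_mon s].
Proof.
move=> sc cs; rewrite /ld_mon -mprodXE /edge_monomial; apply: eq_bigl => e.
rewrite [val e]surjective_pairing mem_zip_saturated // !cs !mem_ladder_path /on_edge.
by rewrite (svalP e) andbT.
Qed.

Lemma LD_generators p :
  (exists2 c, maximal_saturated_chain c & p = edge_monomial k (@edge_var n.+1) c) <->
  exists s, p = 'X_[ld_mon s].
Proof.
split=> [[c /maximal_saturated_chain_ladder[sc [s cs]] ->]|[s ->]].
  by exists s; apply: edge_monomialE.
exists (ladder_path s); first exact: ladder_path_maximal.
by rewrite (@edge_monomialE _ s) //; apply: ladder_path_saturated.
Qed.

Lemma edge_var_bij : bijective (@edge_var n.+1).
Proof.
apply: inj_card_bij; first exact: inj_comp (@cast_ord_inj _ _ _) enum_rank_inj.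
by rewrite card_ord card_L2_edge.
Qed.

Lemma ld_monE s e : ld_mon s (edge_var e) = on_edge s e.
Proof.
rewrite mnm_sumE (eq_bigr (fun e' => (e' == e : nat))); last first.
  by move=> e' _; rewrite mnm1E (bij_eq edge_var_bij).
rewrite big_mkcond (bigD1 e) //= eqxx big1 ?addn0; first by case: ifP.
by move=> e' /negbTE ->; rewrite if_same.
Qed.

Lemma set_lcm_ldE A e : set_lcm ld_mon A (edge_var e) = [exists s in A, on_edge s e].
Proof.
rewrite mnmE; under eq_bigr do rewrite ld_monE.
apply/eqP; rewrite eqn_leq; apply/andP; split.
  by apply/bigmax_leqP => s sA; case se: (on_edge s e) => //; rewrite lt0b;
    apply/exists_inP; exists s.
by case: exists_inP => // -[s sA se]; rewrite (bigD1 s) //= se leq_maxl.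
Qed.

Lemma L2_edge_covers (u : 'I_n.+1 + 'I_2 * 'I_n) :
  covers (L2_edge_pair (n := n.+1) u).1 (L2_edge_pair (n := n.+1) u).2.
Proof. by apply/L2_edge_pairP; exists u. Qed.

Definition ladder_edge (u : 'I_n.+1 + 'I_2 * 'I_n) : hasse_edge L :=
  exist (fun e : L * L => covers e.1 e.2) (L2_edge_pair (n := n.+1) u) (L2_edge_covers u).

Lemma ladder_edge_bij : bijective ladder_edge.
Proof.
apply: inj_card_bij => [u v /(congr1 val)/L2_edge_pair_inj//|].
by rewrite card_L2_edge card_sum card_prod !card_ord; lia.
Qed.

Lemma on_rung s t : on_edge s (ladder_edge (inl t)) = (t == s).
Proof. by rewrite /on_edge /on_path /= -val_eqE eqn_leq. Qed.

Lemma on_rail0 s (t : 'I_n) : on_edge s (ladder_edge (inr (ord0, t))) = (t < s)%N.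
Proof. by rewrite /on_edge /on_path /= /bump /=; lia. Qed.

Lemma on_rail1 s (t : 'I_n) : on_edge s (ladder_edge (inr (ord_max, t))) = (s <= t)%N.
Proof. by rewrite /on_edge /on_path /= /bump /=; lia. Qed.

Lemma set_lcm_ld_strict s A : s \in A -> set_lcm ld_mon (A :\ s) != set_lcm ld_mon A.
Proof.
move=> sA; apply/eqP => /(congr1 (fun a : 'X_{1..m} => a (edge_var (ladder_edge (inl s))))).
rewrite !set_lcm_ldE; case: exists_inP => [[t]|_].
  by rewrite on_rung !inE => /andP[/negbTE ts _]; rewrite eq_sym ts.
by case: exists_inP => // -[]; exists s; rewrite ?on_rung.
Qed.

Definition extremes A (x : 'I_n.+1 * 'I_n.+1) : bool :=
  [&& x.1 \in A, x.2 \in A & [forall s in A, x.1 <= s <= x.2]%N].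

Lemma sum_ord_lt (N q : nat) : (\sum_(t < N) (t < q))%N = minn q N.
Proof. by elim: N => [|N IH]; rewrite ?big_ord0 ?big_ord_recr ?minn0 //= IH; lia. Qed.

(** With minimum [p] and maximum [q], the lcm contains the rungs in [A], the [q] edges of row 0
    before column [q], and the [n - p] edges of row 1 after column [p]. *)
Lemma mdeg_set_lcm_ld A x : extremes A x ->
  mdeg (set_lcm ld_mon A) = (#|A| + (x.2 - x.1) + n)%N.
Proof.
case: x => p q /and3P[/= pA qA /forall_inP ext].
have pn := ltn_ord p; have qn := ltn_ord q; have /andP[_ pq] := ext _ pA.
rewrite mdegE (reindex _ (onW_bij _ edge_var_bij)) /=.
rewrite (reindex _ (onW_bij _ ladder_edge_bij)) /= big_sumType /=.
under eq_bigr do rewrite set_lcm_ldE.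
under [X in (_ + X)%N]eq_bigr do rewrite set_lcm_ldE.
rewrite -addnA; congr addn.
  rewrite -sum1_card [RHS]big_mkcond; apply: eq_bigr => t _; case: ifPn => tA.
    by case: exists_inP => // -[]; exists t => //; rewrite on_rung.
  by case: exists_inP => // -[s sA]; rewrite on_rung => /eqP e; rewrite -e (negbTE tA) in sA.
rewrite (eq_bigr (fun y => [exists s in A, on_edge s (ladder_edge (inr (y.1, y.2)))] : nat));
  last by case.
rewrite -(pair_bigA _ (fun (a : 'I_2) (t : 'I_n) =>
  [exists s in A, on_edge s (ladder_edge (inr (a, t)))] : nat)).
rewrite big_ord_recl big_ord1 (_ : lift ord0 ord0 = ord_max); last exact: val_inj.
rewrite (eq_bigr (fun t : 'I_n => (t < q)%N : nat)) => [|t _]; last first.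
  case: exists_inP => [[s sA]|h].
    by rewrite on_rail0 => /leq_trans-> //; have /andP[] := ext _ sA.
  by case: ltnP => // tq; case: h; exists q; rewrite ?on_rail0.
rewrite sum_ord_lt (eq_bigr (fun t : 'I_n => 1 - (t < p)%N)%N) => [|t _]; last first.
  case: exists_inP => [[s sA]|h].
    by rewrite on_rail1 => st; have /andP[ps _] := ext _ sA; rewrite ltnNge (leq_trans ps).
  by case: ltnP => // pt; case: h; exists p; rewrite ?on_rail1.
rewrite sumnB => [|t _]; last exact: leq_b1.
rewrite sum_ord_lt sum_nat_const card_ord /=; lia.
Qed.

Lemma extremes_ex A : (0 < #|A|)%N -> exists x, forall y, extremes A y = (y == x).
Proof.
case/card_gt0P => s sA.
have [p pA hp] := @arg_minnP _ s (fun t => t \in A) (fun t => t : nat) sA.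
have [q qA hq] := @arg_maxnP _ s (fun t => t \in A) (fun t => t : nat) sA.
exists (p, q) => -[p' q']; apply/and3P/eqP => /= [[pA' qA' /forall_inP ext]|[-> ->]].
  congr (_, _); apply/val_inj/anti_leq.
    by rewrite hp // andbT; have /andP[] := ext _ pA.
  by apply/andP; split; [apply: hq|have /andP[] := ext _ qA].
by split=> //; apply/forall_inP => t tA; rewrite hp //; apply: hq.
Qed.

(** Removing both extremes leaves an arbitrary set of [i] columns strictly between [p] and [q]. *)
Lemma card_extremes (p q : 'I_n.+1) i : (p < q)%N ->
  #|[set A | extremes A (p, q) & #|A| == i.+2]| = 'C(q - p - 1, i).
Proof.
move=> pq; pose J := [set t : 'I_n.+1 | p < t < q]%N.
have cJ : #|J| = (q - p - 1)%N.
  have qn := ltn_ord q.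
  rewrite -sum1_card big_mkcond /=.
  rewrite (eq_bigr (fun t : 'I_n.+1 => (t < q) - (t < p.+1))%N) => [|t _]; last first.
    by rewrite inE; case: ifP; lia.
  by rewrite sumnB ?sum_ord_lt => [|t _]; lia.
have pJ (B : {set 'I_n.+1}) : B \subset J -> p \notin B.
  by move=> /subsetP BJ; apply/negP => /BJ; rewrite inE ltnn.
have qJ (B : {set 'I_n.+1}) : B \subset J -> q \notin B.
  by move=> /subsetP BJ; apply/negP => /BJ; rewrite inE ltnn andbF.
have npq : p != q by rewrite -val_eqE /= ltn_eqF.
rewrite -cJ -cards_draws -(@card_in_imset _ _ (fun B : {set 'I_n.+1} => p |: (q |: B))
  [set B : {set 'I_n.+1} | B \subset J & #|B| == i]); last first.
  move=> B B'; rewrite !inE => /andP[BJ _] /andP[BJ' _] e.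
  have K (C : {set 'I_n.+1}) : C \subset J -> (p |: (q |: C)) :\ p :\ q = C.
    by move=> CJ; rewrite setU1K ?setU1K ?qJ // !inE negb_or npq pJ.
  by rewrite -(K _ BJ) e K.
congr #|pred_of_set _|; apply/setP => A; rewrite inE; apply/andP/imsetP.
  case=> /and3P[/= pA qA /forall_inP ext] /eqP cA; exists (A :\ p :\ q).
    have qAp : q \in A :\ p by rewrite !inE eq_sym npq.
    have c1 := cardsD1 p A; have c2 := cardsD1 q (A :\ p); rewrite pA in c1.
    rewrite qAp in c2; rewrite inE; apply/andP; split; last by move: c1; rewrite cA c2 => -[->].
    apply/subsetP => t; rewrite !inE => /and3P[tq tp /ext]; rewrite -!val_eqE /= in tq tp *.
    lia.
  by rewrite !setD1K // !inE eq_sym npq.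
case=> B; rewrite inE => /andP[BJ /eqP cB] ->; split; last first.
  by rewrite !cardsU1 !inE negb_or npq pJ // qJ // cB.
rewrite /extremes /= !inE !eqxx orbT /=; apply/forall_inP => t; rewrite !inE.
case/or3P => [/eqP->|/eqP->|/(subsetP BJ)]; rewrite ?inE; lia.
Qed.

Lemma card_ord_shift N e : #|[pred x : 'I_N * 'I_N | (x.1 + e)%N == x.2 :> nat]| = (N - e)%N.
Proof.
rewrite -sum1_card big_mkcond /=.
rewrite -(pair_bigA _ (fun p q : 'I_N => if (p + e)%N == q :> nat then 1%N else 0%N)) /=.
rewrite -[RHS](minn_idPl (leq_subr e N)) -sum_ord_lt; apply: eq_bigr => p _.
have [lt|ge] := ltnP (p + e) N.
  rewrite (bigD1 (Ordinal lt)) //= eqxx big1 ?addn0 => [|q]; first by lia.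
  by rewrite -val_eqE /= eq_sym => /negbTE ->.
rewrite big1 => [|q _]; first by lia.
by case: eqP => // pq; have := ltn_ord q; lia.
Qed.

(** Sets are sorted by their extremes [(p, q)]. The degree fixes the spread [e = q - p], which
    [n.+1 - e] pairs realize, each with ['C(e - 1, i)] sets. *)
Lemma card_set_lcm_ld i (j : int) :
  #|[set A : {set 'I_n.+1} | #|A| == i.+2 & (mdeg (set_lcm ld_mon A))%:Z == j]|%:Z =
  if (n.+1%:Z + 2 * i.+2%:Z - 2 <= j) && (j <= 2 * n.+1%:Z + i.+2%:Z - 2)
  then (2 * n.+1%:Z - j + i.+2%:Z - 1) * 'C(`|(j - n.+1%:Z - i.+2%:Z)%R|, i)%N%:Z
  else 0.
Proof.
pose w (x : 'I_n.+1 * 'I_n.+1) :=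
  if (x.1 < x.2)%N && ((i.+2 + (x.2 - x.1) + n)%N%:Z == j) then 'C(x.2 - x.1 - 1, i) else 0%N.
have -> : #|[set A : {set 'I_n.+1} | #|A| == i.+2 & (mdeg (set_lcm ld_mon A))%:Z == j]| =
    (\sum_x w x)%N.
  rewrite -sum1_card (eq_bigr (fun A => \sum_x extremes A x)%N) => [|A]; last first.
    rewrite inE => /andP[/eqP cA _]; have [|x hx] := @extremes_ex A; first by rewrite cA.
    rewrite (bigD1 x) //= hx eqxx big1 ?addn0 // => y; rewrite hx => /negbTE ->; by [].
  rewrite exchange_big; apply: eq_bigr => -[p q] _; rewrite /w /=.
  case: ifP => [/andP[pq /eqP ej]|npq].
    rewrite -(card_extremes i pq) -sum1_card big_mkcond [RHS]big_mkcond /=.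
    apply: eq_bigr => A _; rewrite !inE.
    case: (boolP (extremes A (p, q))) => ext /=; last by rewrite if_same.
    by rewrite (mdeg_set_lcm_ld ext) /=; case: eqP => // ->; rewrite ej eqxx.
  rewrite big1 // => A; rewrite inE => /andP[/eqP cA /eqP dA].
  apply/eqP; rewrite eqb0; apply/negP => ext; move/negbT: npq; case/negP.
  rewrite -dA (mdeg_set_lcm_ld ext) cA eqxx andbT /=.
  have /and3P[/= pA qA /forall_inP h] := ext.
  rewrite ltnNge; apply/negP => qp.
  have : A \subset [set p].
    apply/subsetP => t /h; rewrite inE -val_eqE /=; lia.
  by move/subset_leq_card; rewrite cA cards1.
pose e := `|(j - n%:Z - i.+2%:Z)%R|%N.
(* This is the range [1 <= e <= n] of possible spreads. It starts lower than the range in the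
   statement, but in between [e - 1 < i] and the binomial vanishes. *)
have [je|je] := boolP ((n.+1%:Z + i.+2%:Z <= j) && (j <= 2 * n.+1%:Z + i.+2%:Z - 2)).
  rewrite (eq_bigr (fun x : 'I_n.+1 * 'I_n.+1 =>
      if (x.1 + e)%N == x.2 :> nat then 'C(e - 1, i) else 0%N)) => [|[p q] _]; last first.
    rewrite /w /=; case: ifP => h1; case: ifP => h2 //.
    - congr ('C(_, _)); lia.
    - lia.
    - lia.
  rewrite -big_mkcond sum_nat_const card_ord_shift /=.
  rewrite (_ : (e - 1)%N = `|(j - n.+1%:Z - i.+2%:Z)%R|%N); last by lia.
  case: ifP => h; first by rewrite PoszM; congr (_ * _); lia.
  by rewrite bin_small ?muln0 //; lia.
rewrite big1 => [|[p q] _].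
  by case: ifP => //; lia.
by rewrite /w /=; case: ifP => // h; have := ltn_ord q; lia.
Qed.

End LatticeDiagramIdeal.

(** * The path ideal and its Hilbert-Burch resolution *)

Section PathIdeal.
Variables (k : fieldType) (n : nat).
Local Notation L := (L2 n.+1).
Local Notation m := (2 * n.+1)%N.
Local Notation S := {mpoly k[m]}.
Implicit Types (s t r : nat) (v : L).

Definition path_mon s : 'X_{1..m} := (\sum_(v | on_path s v) U_(vertex_var v))%MM.

Definition bottom t : 'I_m := vertex_var (ord0, inord t).
Definition top t : 'I_m := vertex_var (ord_max, inord t).

Lemma vertex_var_bij : bijective (@vertex_var n.+1).
Proof.
apply: inj_card_bij; first exact: inj_comp (@cast_ord_inj _ _ _) enum_rank_inj.
by rewrite card_ord card_L2.
Qed.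

Lemma path_monE s v : path_mon s (vertex_var v) = on_path s v.
Proof.
rewrite mnm_sumE (eq_bigr (fun v' => (v' == v : nat))); last first.
  by move=> v' _; rewrite mnm1E (bij_eq vertex_var_bij).
rewrite big_mkcond (bigD1 v) //= eqxx big1 ?addn0; first by case: ifP.
by move=> v' /negbTE ->; rewrite if_same.
Qed.

Lemma vertex_monomialE (c : seq L) (s : 'I_n.+1) : perm_eq c (ladder_path s) ->
  vertex_monomial k (@vertex_var n.+1) c = 'X_[path_mon s].
Proof.
move=> cs; rewrite /vertex_monomial (perm_big _ cs) /=.
rewrite big_uniq ?(saturated_uniq (ladder_path_saturated s)) //=.
by rewrite /path_mon -mprodXE; apply: eq_bigl => v; rewrite mem_ladder_path.
Qed.

Lemma path_generators p :
  (exists2 c, saturated_chain c /\ size c = n.+2 &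
     p = vertex_monomial k (@vertex_var n.+1) c) <->
  exists s : 'I_n.+1, p = 'X_[path_mon s].
Proof.
split=> [[c [sc cn] ->]|[s ->]].
  by have [s cs] := saturated_size_perm sc cn; exists s; apply: vertex_monomialE.
exists (ladder_path s); first by rewrite size_ladder_path; split=> //; apply: ladder_path_saturated.
by rewrite (@vertex_monomialE _ s).
Qed.

Lemma mdeg_path_mon s : (s <= n)%N -> mdeg (path_mon s) = n.+2.
Proof.
move=> sn; pose o : 'I_n.+1 := Ordinal (sn : (s < n.+1)%N).
rewrite /path_mon mdeg_sum (eq_bigr (fun=> 1%N)) => [|v _]; last by rewrite mdeg1.
rewrite sum1_card -(size_ladder_path o).
rewrite -(card_uniqP (saturated_uniq (ladder_path_saturated o))).
by apply: eq_card => v; rewrite mem_ladder_path.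
Qed.

(** The paths climbing at [s] and [s.+1] differ in one vertex: the first visits [(1, s)] where the
    second visits [(0, s.+1)]. *)
Lemma path_monS s : (s < n)%N ->
  (U_(bottom s.+1) + path_mon s = U_(top s) + path_mon s.+1)%MM.
Proof.
move=> sn; have [g _ gK] := vertex_var_bij; apply/mnmP => i.
rewrite -(gK i) !mnmDE !path_monE !mnm1E !(bij_eq vertex_var_bij).
case: (g i) => a t; rewrite !xpair_eqE -!val_eqE /= !inordK; try lia.
by rewrite /on_path -!val_eqE /=; have := ltn_ord a; case: (nat_of_ord a) => [|[|?]] /=; lia.
Qed.

Definition path_basis i : seq nat :=
  match i with
  | 0 => [:: 0%N]
  | 1 => index_iota 0 n.+1
  | 2 => index_iota 0 n
  | _ => [::]
  end.

(** Row [t] of the Hilbert-Burch matrix, the linear relation between the generators of the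
    consecutive paths [t] and [t.+1]. *)
Definition syzygy t s : S :=
  if s == t then 'X_(bottom t.+1) else if s == t.+1 then - 'X_(top t) else 0.

Definition path_diff i s t : S :=
  match i with
  | 0 => 'X_[path_mon s]
  | 1 => syzygy s t
  | _ => 0
  end.

Definition path_deg i s : int :=
  match i with 0 => 0 | 1 => n.+2%:Z | _ => n.+3%:Z end.

Definition path_seq : free_seq k m := based_seq 0%N path_basis path_deg path_diff (fun=> 1).

Lemma syzygy_mul t (c : nat -> S) : (t < n)%N ->
  \sum_(0 <= s < n.+1) syzygy t s * c s = 'X_(bottom t.+1) * c t - 'X_(top t) * c t.+1.
Proof.
move=> tn; rewrite (eq_bigr (fun s => (if s == t then 'X_(bottom t.+1) * c s else 0) +
    (if s == t.+1 then - 'X_(top t) * c s else 0))) => [|s _]; last first.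
  rewrite /syzygy; case: eqP => [->|_]; first by rewrite ltn_eqF ?addr0.
  by case: eqP => _; rewrite add0r ?mul0r.
rewrite big_split -!big_mkcond !big_nat1_eq /= mulNr !ifT //; lia.
Qed.

Lemma mem_path_basis1 s : (s \in path_basis 1) = (s <= n)%N.
Proof. by rewrite mem_index_iota. Qed.

Lemma mem_path_basis2 s : (s \in path_basis 2) = (s < n)%N.
Proof. by rewrite mem_index_iota. Qed.

Lemma path_mon_bottom r : (r < n)%N -> path_mon r (bottom r.+1) = 0%N.
Proof. by move=> rn; rewrite path_monE /on_path /= inordK // ltnn. Qed.

Lemma path_mon_bottom_gt s r : (r < s <= n)%N -> path_mon s (bottom r.+1) = 1%N.
Proof. by move=> rsn; rewrite path_monE /on_path /= inordK; lia. Qed.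

Lemma syzygy_relation t : (t < n)%N ->
  'X_(bottom t.+1) * 'X_[path_mon t] - 'X_(top t) * 'X_[path_mon t.+1] = 0 :> S.
Proof. by move=> tn; rewrite -!mpolyXD path_monS // subrr. Qed.

(* Among the monomials of the paths [r, ..., n] only that of [r] is free of the
   variable [bottom r.+1], so this variable divides [c r]; subtracting a
   multiple of [syzygy r] then removes [r] from the relation. *)
Lemma syzygies_generate r (c : nat -> S) : (r <= n)%N ->
    \sum_(r <= s < n.+1) c s * 'X_[path_mon s] = 0 ->
  exists e, forall s, (r <= s <= n)%N -> c s = \sum_(r <= t < n) e t * syzygy t s.
Proof.
move En: (n - r)%N => d; elim: d r c En => [|d IH] r c En rn rel.
  have {}rn : r = n by lia.
  subst r; move: rel; rewrite big_nat1 => cn; exists (fun=> 0) => s sn.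
  have -> : s = n by lia.
  by rewrite big_geq //; apply: (mulIX (b := path_mon n)); rewrite cn mul0r.
have rltn : (r < n)%N by lia.
have /mon_divK cr a : (c r)@_a != 0 -> (U_(bottom r.+1) <= a)%MM.
  rewrite -(mcoeffMX _ (path_mon r)) => nz.
  have : (U_(bottom r.+1) <= path_mon r + a)%MM.
    apply: contraNT nz => le; move: rel; rewrite big_ltn; last by lia.
    move/(congr1 (mcoeff (path_mon r + a)%MM)); rewrite mcoeffD mcoeff0 raddf_sum /=.
    rewrite big1_seq ?addr0 => [->//|s]; rewrite mem_index_iota => rs.
    apply/eqP; apply: contraNT le => /mcoeffMX_neq0/mnm_lepP/(_ (bottom r.+1)).
    by rewrite path_mon_bottom_gt ?lep1mP; lia.
  by rewrite !lep1mP mnmDE path_mon_bottom.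
set q := mon_div _ _ in cr.
(* Since [bottom r.+1] times the monomial of [r] equals [top r] times that of [r.+1], the term of
   [r] is absorbed by adding [q * 'X_(top r)] to the coefficient of [r.+1]. *)
have [|||e he] := IH r.+1 (fun s => if s == r.+1 then c s + q * 'X_(top r) else c s); try lia.
  rewrite big_ltn ?eqxx; last by lia.
  rewrite -[RHS]rel (@big_ltn _ _ _ r); last by lia.
  rewrite (@big_ltn _ _ _ r.+1 n.+1); last by lia.
  rewrite -{1}cr mulrDl addrA; congr (_ + _).
    by rewrite addrC -!mulrA -!mpolyXD path_monS.
  by apply: eq_big_seq => s; rewrite mem_index_iota; case: eqP => //; lia.
exists (fun t => if t == r then q else e t) => s rs; rewrite big_ltn // eqxx.
rewrite (eq_big_seq (fun t => e t * syzygy t s)) => [|t]; last first.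
  by rewrite mem_index_iota; case: eqP => //; lia.
have [sr|sr] := eqVneq s r.
  rewrite big1_seq ?addr0 => [|t]; first by rewrite sr /syzygy eqxx -cr.
  by rewrite mem_index_iota /syzygy => rt; rewrite !ifN ?mulr0 //; lia.
rewrite -he; last by lia.
rewrite /syzygy (negbTE sr); case: eqP => _; last by rewrite mulr0 add0r.
by rewrite mulrN addrCA addNr addr0.
Qed.

Lemma path_exact i (c : nat -> S) :
    {in path_basis i, forall t, \sum_(s <- path_basis i.+1) c s * path_diff i s t = 0} <->
  exists e, {in path_basis i.+1, forall s,
    c s = \sum_(r <- path_basis i.+2) e r * path_diff i.+1 r s}.
Proof.
case: i => [|[|i]].
- split=> [/(_ 0%N (mem_head _ _)) /= rel|[e he] t _].
    have [e he] := syzygies_generate (leq0n n) rel.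
    by exists e => s; rewrite mem_path_basis1 => sn; apply: he.
  rewrite (eq_big_seq (fun s => (\sum_(r <- path_basis 2) e r * syzygy r s) * 'X_[path_mon s])).
    under eq_bigr do rewrite mulr_suml.
    rewrite exchange_big big1_seq //= => r; rewrite mem_index_iota => rn.
    under eq_bigr do rewrite -mulrA.
    by rewrite -mulr_sumr syzygy_mul // syzygy_relation // mulr0.
  by move=> s sb; rewrite he.
- split=> [rel|[e he] t _]; last first.
    by rewrite big1_seq // => s /he ->; rewrite big_nil mul0r.
  exists (fun=> 0) => s; rewrite mem_path_basis2 big_nil.
  (* Injectivity of the last map: column [s] of the relation involves only [c s] and the preceding
     coefficient, which is zero by induction, so a variable times [c s] is zero. *)
  elim/ltn_ind: s => s IH sn; apply: (mulIX (b := U_(bottom s.+1))).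
  have := rel s; rewrite mem_path_basis1 => /(_ (ltnW sn)).
  rewrite mul0r => <-; rewrite /= (bigD1_seq s) ?mem_index_iota ?iota_uniq //=.
  rewrite /syzygy eqxx big1_seq ?addr0 // => t /andP[ts]; rewrite mem_index_iota => tn.
  rewrite eq_sym (negbTE ts); case: eqP => [st|]; last by rewrite mulr0.
  by rewrite (IH t) ?mul0r //; lia.
split=> [_|_ t _]; first by exists (fun=> 0).
by rewrite big_nil.
Qed.

Lemma path_minimal_resolution :
  minimal_graded_resolution (I_path k n.+1 n.+2) path_seq.
Proof.
split.
- apply: based_graded => [[|[|i]] s t|t] //.
  + rewrite mem_path_basis1 => sn _; apply/homog_intP => a; rewrite mcoeffX.
    have [<- _|_] := eqVneq (path_mon s) a; last by rewrite eqxx.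
    by rewrite mdeg_path_mon //=; lia.
  + move=> _ _; rewrite /= /syzygy (_ : n.+3%:Z - n.+2%:Z = 1%N :> int) /=; last by lia.
    case: ifP => _; [|case: ifP => _]; rewrite ?rpredN ?rpred0 ?dhomogX //; apply/eqP/mdeg1.
  + by move=> _; apply: dhomog1.
- apply: based_resolution => [[|[|[|i]]]|||]; rewrite ?iota_uniq //; last exact: path_exact.
    by exists (fun=> 1); rewrite big_seq1 mulr1 subrr; apply: ideal_gen0.
  move=> c; rewrite big_seq1 mulr1.
  apply: iff_trans (mem_monomial_ideal path_generators _) _.
  have e0 (e : nat -> S) : \sum_(s <- path_basis 1) e s * path_diff 0 s 0 =
      \sum_(s < n.+1) e s * 'X_[path_mon s] by rewrite big_mkord.
  split=> [[f cf]|[e /(_ 0%N (mem_head _ _))]]; last first.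
    by rewrite e0 => ->; exists (fun s : 'I_n.+1 => e s).
  exists (fun s => f (inord s)) => t; rewrite mem_seq1 => /eqP ->; rewrite e0 cf.
  by apply: eq_bigr => s _; rewrite inord_val.
apply: based_minimal => -[|[|i]] s t; rewrite /= ?mcoeff0 //.
  rewrite mem_path_basis1 => sn _; rewrite mcoeffX.
  have [e|//] := eqVneq (path_mon s) 0%MM.
  by have := mdeg_path_mon sn; rewrite e mdeg0.
move=> _ _; rewrite /syzygy; case: ifP => _; [|case: ifP => _];
  by rewrite ?mcoeffN ?mcoeffX ?mcoeff0 ?mnm1_eq0 ?oppr0.
Qed.

End PathIdeal.

(** * Betti numbers read off the two resolutions *)

Lemma LD_minimal_resolution (k : fieldType) n :
  minimal_graded_resolution (I_LD k n.+1) (taylor_seq k (@ld_mon n)).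
Proof.
apply: taylor_minimal_resolution => [p|s A]; first exact: LD_generators.
exact: set_lcm_ld_strict.
Qed.

Lemma LD_homog (k : fieldType) n p :
  (exists2 c, maximal_saturated_chain c & p = edge_monomial k (@edge_var n.+1) c) ->
  exists e, homog_int e p.
Proof.
move/LD_generators => [s ->]; exists (mdeg (ld_mon s))%:Z.
by rewrite /= dhomogX.
Qed.

Lemma path_homog (k : fieldType) n p :
  (exists2 c, saturated_chain c /\ size c = n.+2 &
     p = vertex_monomial k (@vertex_var n.+1) c) ->
  exists e, homog_int e p.
Proof.
move/path_generators => [s ->]; exists (mdeg (path_mon n s))%:Z.
by rewrite /= dhomogX.
Qed.

Lemma betti_LD (k : fieldType) n i (j : int) : graded_betti (I_LD k n.+1) i j =
  #|[set A : {set 'I_n.+1} | #|A| == i & (mdeg (set_lcm (@ld_mon n) A))%:Z == j]|.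
Proof.
rewrite (graded_betti_eq (@LD_homog k n) i j (LD_minimal_resolution k n)) /=.
rewrite count_map -size_filter cardE /taylor_basis /enum_mem -filter_predI.
by congr size; apply: eq_filter => A; rewrite /= !inE andbC.
Qed.

Lemma betti_path (k : fieldType) n i (j : int) :
  graded_betti (I_path k n.+1 n.+2) i j = count_mem j [seq path_deg n i s | s <- path_basis n i].
Proof. exact: (graded_betti_eq (@path_homog k n) i j (path_minimal_resolution k n)). Qed.

(** The resolution is pure: in each homological degree all generators share one degree. *)
Lemma betti_path_const (k : fieldType) n i (j : int) :
  graded_betti (I_path k n.+1 n.+2) i j =
  if j == path_deg n i 0 then size (path_basis n i) else 0%N.
Proof.
rewrite betti_path count_map (eq_count (a2 := fun=> j == path_deg n i 0)).
  by case: eqP => _; rewrite ?count_predT ?count_pred0.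
by case: i => [|[|i]] s; rewrite /= eq_sym.
Qed.

Theorem theorem5p11 (k : fieldType) (n : nat) (hn : (2 <= n)%N) :
  [/\ graded_betti (I_LD k n) 0 0 = 1%N,
      graded_betti (I_LD k n) 1 n%:Z = n,
      (forall (i : nat) (j : int), (2 <= i <= n)%N ->
         (graded_betti (I_LD k n) i j)%:Z =
           if (n%:Z + 2 * i%:Z - 2 <= j) && (j <= 2 * n%:Z + i%:Z - 2)
           then (2 * n%:Z - j + i%:Z - 1) * 'C(`|(j - n%:Z - i%:Z)%R|, i - 2)%N%:Z
           else 0),
      (forall (i : nat) (j : int), (n + 1 < i)%N ->
         graded_betti (I_LD k n) i j = 0%N)
    & (forall i : nat, (i <= n)%N -> total_betti (I_LD k n) i = 'C(n, i))]
  /\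
  [/\ graded_betti (I_path k n n.+1) 0 0 = 1%N,
      graded_betti (I_path k n n.+1) 1 (n.+1)%:Z = n,
      graded_betti (I_path k n n.+1) 2 (n.+2)%:Z = (n - 1)%N
    & forall (i : nat) (j : int),
        (i, j) <> (0%N, 0) -> (i, j) <> (1%N, (n.+1)%:Z) ->
        (i, j) <> (2%N, (n.+2)%:Z) ->
        graded_betti (I_path k n n.+1) i j = 0%N].
Proof.
(* From here [n] is one less than in the statement, matching the resolutions above. *)
case: n hn => // n hn; split; split.
- rewrite betti_LD -[RHS](cards1 (set0 : {set 'I_n.+1})).
  congr #|pred_of_set _|; apply/setP => A; rewrite !inE cards_eq0.
  by case: eqP => //= ->; rewrite set_lcm0 mdeg0.
- rewrite betti_LD -[RHS](bin1 n.+1) -[in RHS](card_ord n.+1) -card_draws.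
  congr #|pred_of_set _|; apply/setP => A; rewrite !inE.
  case: cards1P => //= -[s ->].
  (* A singleton is its own minimum and maximum, so its spread is 0 and the degree is [n.+1]. *)
  rewrite (@mdeg_set_lcm_ld _ _ (s, s)); first by rewrite cards1 subnn addn0 add1n eqxx.
  by rewrite /extremes /= set11; apply/forall_inP => t /set1P ->; rewrite leqnn.
- by case=> [|[|i]] j //= _; rewrite betti_LD card_set_lcm_ld !subSS subn0.
- move=> i j ni; rewrite betti_LD; apply/eqP; rewrite cards_eq0 -subset0.
  apply/subsetP => A; rewrite !inE => /andP[/eqP cA _].
  by have := max_card (mem A); rewrite cA card_ord; lia.
- move=> i _; rewrite (total_betti_eq (@LD_homog k n) i (LD_minimal_resolution k n)) /=.
  by rewrite size_map -cardE card_draws card_ord.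
- by rewrite betti_path_const.
- by rewrite betti_path_const eqxx /= size_iota.
- by rewrite betti_path_const eqxx size_iota subSS.
move=> [|[|[|i]]] j h0 h1 h2; rewrite betti_path_const //=; case: eqP => // e.
- by case: h0; rewrite e.
- by case: h1; rewrite e.
by case: h2; rewrite e.
Qed.
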